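(* Let $X$ be a complete and connected Finsler manifold of class $C^2$, let $F$ be a real Banach space, and let $f:X\to F$ be a $C^1$ submersion with uniformly split kernels and with locally Lipschitz derivative. Let $c>0$ be a constant for which there exists a locally Lipschitz right inverse $s$ of $df$ such that $\operatorname{Sur} df(x)\le c\,\|s(x)\|^{-1}$ for every $x\in X$. Let $x_0\in X$ and for each $\rho>0$ let $$\eta(\rho)=\frac1c\inf_{d_X(x_0,x)\le \rho}\operatorname{Sur} df(x).$$ Given $r>0$ set $\varrho(r)=\int_0^r\eta(\rho)\,d\rho$. If $\varrho=\varrho(r)>0$, then $$B_{\varrho}(f(x_0))\subset f(B_r(x_0)),$$ where $B_\varrho(f(x_0))$ and $B_r(x_0)$ are the open balls in $F$ and in $(X,d_X)$ respectively.
   Context: Manifolds are paracompact, real Banach manifolds without boundary. A Finsler manifold (in the sense of Palais) is a manifold $X$ modeled on a Banach space $(E,|\cdot|)$ with a continuous map $\|\cdot\|_X:TX\to[0,\infty)$ such that (1) for every $x\in X$, $v\mapsto\|v\|_x:=\|(x,v)\|_X$ is a norm on $T_xX$ which in every chart at $x$ is equivalent to $|\cdot|$; (2) for every $x_0\in X$ and $k>1$ there is a chart $(W,\varphi)$ at $x_0$ such that for all $x\in W$ and $w\in E$, $k^{-1}\|v_{x_0}(w)\|_{x_0}\le\|v_x(w)\|_x\le k\|v_{x_0}(w)\|_{x_0}$, where $v_x(w)=d(\varphi^{-1})(\varphi(x))w$. If $X$ is connected, $d_X(x,x')$ is the infimum of the lengths $\int_a^b\|\dot\alpha(t)\|\,dt$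 of $C^1$ paths $\alpha:[a,b]\to X$ joining $x$ to $x'$; $X$ is complete if $(X,d_X)$ is a complete metric space. The Banach space $F$ carries the Finsler structure $\|(y,v)\|=|v|$. A submersion is a $C^1$ map $f$ with $df(x)$ onto for all $x$. $f$ has uniformly split kernels if there is a constant $C>0$ such that for each $x\in X$ there is a bounded linear projection $P_x:T_xX\to T_xX$ with $\ker P_x=\ker df(x)$ and $\|P_x\|_x\le C$. ''Locally Lipschitz derivative'' means that the derivative of $f$ is locally Lipschitz when expressed in charts. The surjectivity indicator is $\operatorname{Sur} df(x)=\inf\{\|df(x)^*v^*\|_x : v^*\in F^*,\ |v^*|=1\}$, with dual norms on $F^*$ and $(T_xX)^*$. A locally Lipschitz right inverse of $df$ is a family of bounded linear maps $s(x):F\to T_xX$, $x\in X$ (i.e. a bundle map $s:f^*(TF)\to TX$), such that $df(x)s(x)=\mathrm{id}_F$ for all $x$, and which is locally Lipschitz in charts: for every chart $(W,\varphi)$ at $x$ and every chart $(U,\psi)$ at $f(x)$ with $f(W)\subset U$, the map $\zeta\mapsto d\varphi(\varphi^{-1}(\zeta))\,s(\varphi^{-1}(\zeta))\,[d\psi(f(\varphi^{-1}(\zeta)))]^{-1}$ is locally Lipschitz on $\varphi(W)$. $\|s(x)\|$ is the operator norm. (For a submersion as in the claim, such a pair $s$, $c$ always exists.) *)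

(* Defs.v *)
From HB Require Import structures.
From mathcomp Require Import all_boot all_order all_algebra.
From mathcomp Require Import all_classical all_reals all_analysis.

Set Implicit Arguments.
Unset Strict Implicit.
Unset Printing Implicit Defensive.
Import Order.TTheory GRing.Theory Num.Theory.
Import numFieldNormedType.Exports.
Local Open Scope classical_set_scope.
Local Open Scope ring_scope.

(* Norms of vectors and of linear maps take values in \bar R, so that the norm
   of an unbounded map is +oo and infima over empty sets are +oo; a linear map
   is bounded iff its norm is < +oo. *)

Definition enorm {R : realType} {V : normedModType R} (v : V) : \bar R :=
  (`|v|)%:E.

Definition opnorm (R : realType) (V W : lmodType R)
    (p : V -> \bar R) (q : W -> \bar R) (T : V -> W) : \bar R :=
  ereal_sup [set q (T v) | v in [set v | (p v <= 1)%E]].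

Section calculus.
Context {R : realType} {V W : normedModType R}.
Implicit Types (U : set V) (g : V -> W).

Definition C1_on U g := forall x, U x ->
  differentiable g x /\
  forall e : R, 0 < e ->
    \forall y \near x, (opnorm enorm enorm ('d g y \- 'd g x)%R <= e%:E)%E.

(* [B] is the second derivative: x |-> 'd g x is Frechet differentiable for
   the operator norm, with derivative x |-> B x continuous for the norm of
   bilinear maps. *)
Definition C2_on U g := C1_on U g /\
  exists B : V -> V -> V -> W, forall x, U x ->
  [/\ linear (B x) /\ (forall h, linear (B x h)),
      (opnorm enorm (opnorm enorm enorm) (B x) < +oo)%E,
      forall e : R, 0 < e -> \forall y \near x,
        (opnorm enorm enorm ('d g y \- 'd g x \- B x (y - x))%R
           <= (e * `|y - x|)%:E)%E
    & forall e : R, 0 < e -> \forall y \near x,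
        (opnorm enorm (opnorm enorm enorm) (B y \- B x)%R <= e%:E)%E].

End calculus.

Definition loc_lipschitz_op (R : realType) (V V' W : normedModType R)
    (U : set V) (A : V -> V' -> W) :=
  forall x, U x -> exists k : R, exists2 O : set V, nbhs x O &
    forall y z, (O `&` U) y -> (O `&` U) z ->
      (opnorm enorm enorm (A y \- A z)%R <= (k * `|y - z|)%:E)%E.

Definition paracompact (X : topologicalType) :=
  forall C : set (set X),
    (forall A, C A -> open A) -> \bigcup_(A in C) A = setT ->
  exists D : set (set X),
    [/\ forall A, D A -> open A,
        \bigcup_(A in D) A = setT,
        forall A, D A -> exists2 B, C B & A `<=` B
      & forall x : X, exists2 O, nbhs x O &
          finite_set [set A | D A /\ A `&` O !=set0]].

(* The values of [cmap] outside [cdom] and of [cinv] outside the image of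
   [cdom] are irrelevant. *)
Record chart (R : realType) (X : topologicalType) (E : normedModType R) :=
  Chart {
  cdom : set X ;
  cmap : X -> E ;
  cinv : E -> X ;
  cdom_open : open cdom ;
  cran_open : open (cmap @` cdom) ;
  cmapK : forall x, cdom x -> cinv (cmap x) = x ;
  cmap_continuous : {within cdom, continuous cmap} ;
  cinv_continuous : {within cmap @` cdom, continuous cinv} }.

Section charts.
Context {R : realType} {X : topologicalType} {E : normedModType R}.
Implicit Types c d : chart X E.

Definition cran c : set E := cmap c @` cdom c.

Definition overlap c d : set E := cmap c @` (cdom c `&` cdom d).

Definition transition c d : E -> E := cmap d \o cinv c.

Definition C2_compatible c d :=
  C2_on (overlap c d) (transition c d) /\ C2_on (overlap d c) (transition d c).

End charts.

(* Banach manifold of class C^2 without boundary modelled on E; [atlas] is the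
   maximal atlas, so "a chart of X" is an element of [atlas]. *)
Record C2manifold (R : realType) (X : topologicalType)
    (E : completeNormedModType R) := C2Manifold {
  atlas : set (chart X E) ;
  atlas_cover : forall x, exists c, atlas c /\ cdom c x ;
  atlas_compatible : forall c d, atlas c -> atlas d -> C2_compatible c d ;
  atlas_maximal : forall c,
    (forall d, atlas d -> C2_compatible c d) -> atlas c ;
  manifold_hausdorff : hausdorff_space X ;
  manifold_paracompact : paracompact X }.

Definition chart_at (R : realType) (X : topologicalType)
    (E : completeNormedModType R) (M : C2manifold X E) (x : X)
    (c : chart X E) := atlas M c /\ cdom c x.

Lemma near_eq_diff (R : realType) (V W : normedModType R) (f g : V -> W) x :
  differentiable f x -> (\forall y \near x, g y = f y) -> is_diff x g ('d f x).
Proof.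
move=> df gf; have gfx := nbhs_singleton gf.
have gE : g \o shift x = cst (g x) + 'd f x +o_ 0 id.
  apply/eqaddoP => e e0; have /diff_locallyP[_ /eqaddoP/(_ e e0) dfx] := df.
  move: gf dfx; rewrite (near_shift 0 x) subr0 => gf dfx.
  near=> h; rewrite !fctE gfx.
  have -> : g (h + x) = f (h + x) by near: h.
  by near: h.
have dE : 'd g x = 'd f x :> (V -> W).
  exact: diff_unique (diff_continuous df) gE.
apply: DiffDef => //; apply/diff_locallyP; rewrite dE; split => //.
exact: diff_continuous df.
Unshelve. all: by end_near. Qed.

Section tangent_space.
Context {R : realType} {X : topologicalType} {E : completeNormedModType R}.
Variable M : C2manifold X E.
Implicit Types (x : X) (c d : chart X E).

(* A tangent vector at x is the family of its coordinates in all the charts at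
   x, related by the derivatives of the transition maps.  It is extended by 0
   to the other charts so that equality of vectors is equality of families. *)
Definition tangent_pred x : {pred chart X E -> E} := fun v =>
  `[< (forall c d, chart_at M x c -> chart_at M x d ->
         v d = 'd (transition c d) (cmap c x) (v c)) /\
      (forall c, ~ chart_at M x c -> v c = 0) >].

Fact tangent_pred_submod x : GRing.submod_closed (tangent_pred x).
Proof.
split.
  apply/asboolP; split=> [c d _ _|//].
  by rewrite linear0.
move=> a u v /asboolP[uE u0] /asboolP[vE v0]; apply/asboolP; split=> [c d cx dx|c cx].
  by rewrite addrfctE scalrfctE /= (uE c d)// (vE c d)// linearP.
by rewrite addrfctE scalrfctE /= u0// v0// scaler0 addr0.
Qed.

HB.instance Definition _ x :=
  GRing.isSubmodClosed.Build R (chart X E -> E) (tangent_pred x)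
    (GRing.submod_closed_semi (tangent_pred_submod x)).

Record tangent x := Tangent {
  tcoord :> chart X E -> E ;
  tangentP : tcoord \in tangent_pred x }.

HB.instance Definition _ x := [isSub for @tcoord x].
HB.instance Definition _ x := [Choice of tangent x by <:].
HB.instance Definition _ x := [SubChoice_isSubLmodule of tangent x by <:].

Lemma near_overlap c d x : chart_at M x c -> chart_at M x d ->
  \forall z \near cmap c x, cran c z /\ cdom d (cinv c z).
Proof.
move=> [_ cx] [_ dx]; near=> z; split; near: z.
  by apply: open_nbhs_nbhs; split; [exact: cran_open | exists x].
have := @cinv_continuous _ _ _ c.
rewrite continuous_open_subspace; last exact: cran_open.
move=> /(_ (cmap c x)); rewrite inE => /(_ (ex_intro2 _ _ x cx erefl)).
apply; rewrite cmapK//.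
by apply: open_nbhs_nbhs; split => //; exact: cdom_open.
Unshelve. all: by end_near. Qed.

Lemma transition_differentiable c d x : chart_at M x c -> chart_at M x d ->
  differentiable (transition c d) (cmap c x).
Proof.
move=> [Mc cx] [Md dx]; have [[Cd _] _] := atlas_compatible Mc Md.
by have [] := Cd (cmap c x) (ex_intro2 _ _ x (conj cx dx) erefl).
Qed.

Lemma transition_chain c d b x : chart_at M x c -> chart_at M x d ->
    chart_at M x b ->
  'd (transition c b) (cmap c x) =
  'd (transition d b) (cmap d x) \o 'd (transition c d) (cmap c x) :> (E -> E).
Proof.
move=> cx dx bx.
have E1 : transition c d (cmap c x) = cmap d x.
  by rewrite /transition /= cmapK//; case: cx.
rewrite -E1 -diff_comp; first last.
- by rewrite E1; exact: transition_differentiable.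
- exact: transition_differentiable.
suff /@diff_val -> : is_diff (cmap c x) (transition d b \o transition c d)
  ('d (transition c b) (cmap c x)) by [].
apply: near_eq_diff; first exact: transition_differentiable.
near=> z; rewrite /transition /=.
have [_ dz] : cran c z /\ cdom d (cinv c z) by near: z; exact: near_overlap.
by rewrite cmapK.
Unshelve. all: by end_near. Qed.

(* The vector d(c^-1)(c x) w of T_xX, i.e. the one whose coordinate in c is w
   (zero if c is not a chart at x). *)
Definition tvec_coord c x (w : E) : chart X E -> E := fun d =>
  if `[< chart_at M x c /\ chart_at M x d >]
  then 'd (transition c d) (cmap c x) w else 0.

Fact tvec_subproof c x w : tvec_coord c x w \in tangent_pred x.
Proof.
apply/asboolP; split=> [d b dx bx|d ndx]; last first.
  by rewrite /tvec_coord; case: asboolP => // -[].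
rewrite /tvec_coord; case: asboolP => [[cx _]|ncb]; case: asboolP => [[cx' _]|ncd].
- by rewrite (transition_chain cx dx bx).
- by case: ncd.
- by case: ncb.
- by rewrite linear0.
Qed.

Definition tvec c x w : tangent x := Tangent (tvec_subproof c x w).

Lemma tvecE c x w : chart_at M x c -> tvec c x w c = w.
Proof.
move=> cx; rewrite /= /tvec_coord; case: asboolP => [_|[]//].
suff /@diff_val -> : is_diff (cmap c x) (transition c c) ('d id (cmap c x)).
  by rewrite diff_val.
apply: near_eq_diff => //; near=> z.
have [[y cy <-] _] : cran c z /\ cdom c (cinv c z).
  by near: z; exact: near_overlap.
by rewrite /transition /= cmapK.
Unshelve. all: by end_near. Qed.

(* The tangent bundle, with the topology for which the bundle charts
   (z, w) |-> (c^-1 z, d(c^-1)(z) w) on (cran c) * E are homeomorphisms onto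
   open sets. *)
Record tbundle := TBundle { tb_base : X ; tb_vec : tangent tb_base }.

Definition tb_chart c (p : E * E) : tbundle :=
  TBundle (tvec c (cinv c p.1) p.2).

Definition tb_open : set (set tbundle) := [set A | forall c, atlas M c ->
  open [set p : E * E | cran c p.1 /\ A (tb_chart c p)]].

Fact tb_openT : tb_open setT.
Proof.
move=> c Mc; have -> : [set p : E * E | cran c p.1 /\ setT (tb_chart c p)] =
  fst @^-1` cran c by apply/seteqP; split => p //= -[].
by apply: open_comp (cran_open c) => p _; exact: cvg_fst.
Qed.

Fact tb_openI : setI_closed tb_open.
Proof.
move=> A B oA oB c Mc; have := openI (oA c Mc) (oB c Mc); congr open.
by apply/seteqP; split => p /=; [move=> [[? ?] [_ ?]] | move=> [? [? ?]]].
Qed.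

Fact tb_open_bigU (I : Type) (A : I -> set tbundle) :
  (forall i, tb_open (A i)) -> tb_open (\bigcup_i A i).
Proof.
move=> oA c Mc.
have := @bigcup_open _ I setT _ (fun i _ => oA i c Mc); congr open.
apply/seteqP; split => p /=; first by move=> [i _ [? ?]]; split=> //; exists i.
by move=> [? [i _ ?]]; exists i.
Qed.

HB.instance Definition _ := gen_eqMixin tbundle.
HB.instance Definition _ := gen_choiceMixin tbundle.
HB.instance Definition _ :=
  isOpenTopological.Build tbundle tb_openT tb_openI tb_open_bigU.

End tangent_space.

Record finsler (R : realType) (X : topologicalType)
    (E : completeNormedModType R) (M : C2manifold X E) := Finsler {
  fnorm : forall x, tangent M x -> R ;
  fnorm_ge0 : forall x (v : tangent M x), 0 <= fnorm v ;
  fnorm_eq0 : forall x (v : tangent M x), fnorm v = 0 -> v = 0 ;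
  fnormD : forall x (u v : tangent M x), fnorm (u + v) <= fnorm u + fnorm v ;
  fnormZ : forall x (a : R) (v : tangent M x), fnorm (a *: v) = `|a| * fnorm v ;
  fnorm_continuous : continuous (fun p : tbundle M => fnorm (tb_vec p)) ;
  fnorm_equiv : forall x c, chart_at M x c ->
    exists m k : R, [/\ 0 < m, 0 < k & forall w : E,
      m * `|w| <= fnorm (tvec M c x w) <= k * `|w|] ;
  fnorm_palais : forall (x0 : X) (k : R), 1 < k ->
    exists2 c, chart_at M x0 c & forall x, cdom c x -> forall w : E,
      k^-1 * fnorm (tvec M c x0 w) <= fnorm (tvec M c x w)
        <= k * fnorm (tvec M c x0 w) }.

Section distance.
Context {R : realType} {X : topologicalType} {E : completeNormedModType R}.
Context {M : C2manifold X E}.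
Variable N : finsler M.

Definition tnorm {x : X} (v : tangent M x) : \bar R := (fnorm N v)%:E.

(* [v] is the velocity of the C^1 path [alpha] on [a, b] (one-sided at the
   endpoints). *)
Definition C1_path (a b : R) (alpha : R -> X)
    (v : forall t, tangent M (alpha t)) : Prop :=
  [/\ {within `[a, b], continuous alpha},
      forall t, t \in `[a, b] -> forall c, chart_at M (alpha t) c ->
        (s - t)^-1 *: (cmap c (alpha s) - cmap c (alpha t))
          @[s --> within [set s | s \in `[a, b] /\ s != t] (nbhs t)]
        --> v t c
    & {within `[a, b], continuous
        (fun t => TBundle (v t))}].

Definition fdist (x y : X) : \bar R := ereal_inf [set l | exists a b : R,
  exists alpha : R -> X, exists v : forall t, tangent M (alpha t),
    [/\ a < b, C1_path a b v, alpha a = x, alpha b = y &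
      l = (\int[lebesgue_measure]_(t in `[a, b]) tnorm (v t))%E]].

Definition fcomplete := forall u : nat -> X,
  (forall e : R, 0 < e -> exists n0, forall m n, (n0 <= m)%N -> (n0 <= n)%N ->
     (fdist (u m) (u n) < e%:E)%E) ->
  exists l : X, forall e : R, 0 < e ->
    exists n0, forall n, (n0 <= n)%N -> (fdist (u n) l < e%:E)%E.

End distance.

(* The charts of a Banach space F, as a manifold of class C^2 modelled on
   itself: those which are C^2-compatible with the identity. *)
Definition vchart (R : realType) (F : normedModType R) : set (chart F F) :=
  [set d | C2_on (cdom d) (cmap d) /\ C2_on (cran d) (cinv d)].

Section maps.
Context {R : realType} {X : topologicalType} {E F : completeNormedModType R}.
Context {M : C2manifold X E}.
Variable N : finsler M.
Implicit Types (f : X -> F) (x : X).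

Definition charts_for f (c : chart X E) (d : chart F F) : Prop :=
  [/\ atlas M c, vchart d & forall x, cdom c x -> cdom d (f x)].

Definition local_rep f (c : chart X E) (d : chart F F) : E -> F :=
  cmap d \o f \o cinv c.

Definition C1_map f := continuous f /\
  forall c d, charts_for f c d -> C1_on (cran c) (local_rep f c d).

Definition loc_lipschitz_derivative f := forall c d, charts_for f c d ->
  loc_lipschitz_op (cran c) (fun z => 'd (local_rep f c d) z).

(* The derivative T_xX -> F, computed in some chart at x. *)
Definition tdiff f x (v : tangent M x) : F :=
  let c := projT1 (cid (atlas_cover M x)) in 'd (f \o cinv c) (cmap c x) (v c).

Lemma tdiffE f x c (v : tangent M x) : chart_at M x c ->
  differentiable (f \o cinv c) (cmap c x) ->
  tdiff f v = 'd (f \o cinv c) (cmap c x) (v c).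
Proof.
move=> cx fc; rewrite /tdiff; case: cid => b bx /=.
have /asboolP[vE _] := tangentP v; rewrite (vE _ _ bx cx).
have E1 : transition b c (cmap b x) = cmap c x.
  by rewrite /transition /= cmapK//; case: bx.
have dbc := transition_differentiable bx cx.
suff /@diff_val -> : is_diff (cmap b x) (f \o cinv b)
    ('d ((f \o cinv c) \o transition b c) (cmap b x)).
  by rewrite diff_comp//= E1.
apply: near_eq_diff.
  by apply: (differentiable_comp dbc); rewrite E1.
near=> z; rewrite /transition /=.
have [_ cz] : cran b z /\ cdom c (cinv b z) by near: z; exact: (near_overlap bx cx).
by rewrite cmapK.
Unshelve. all: by end_near. Qed.

Definition submersion f :=
  C1_map f /\ forall x (y : F), exists v : tangent M x, tdiff f v = y.

Definition unif_split_kernels f := exists2 C : R, 0 < C &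
  forall x, exists P : {linear tangent M x -> tangent M x},
    [/\ forall v, P (P v) = P v,
        forall v, P v = 0 <-> tdiff f v = 0
      & (opnorm (tnorm N) (tnorm N) P <= C%:E)%E].

(* Sur df(x); the linear form phi \o df(x) is df(x)^* phi. *)
Definition Sur f x : \bar R :=
  ereal_inf [set opnorm (@tnorm _ _ _ _ N x) enorm
                   ((phi : F -> R) \o @tdiff f x)
            | phi in [set phi : {scalar F} |
                opnorm enorm enorm (phi : F -> R) = 1%E]].

(* In the charts c at x and d at f x, s is read as dc(x) s(x) [dd(f x)]^-1,
   where dc(x) is the coordinate in c, and [dd(f x)]^-1 is the derivative of
   d^-1 at d (f x). *)
Definition loc_lipschitz_right_inverse f
    (s : forall x, {linear F -> tangent M x}) : Prop :=
  [/\ forall x, (opnorm enorm (tnorm N) (s x) < +oo)%E,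
      forall x y, tdiff f (s x y) = y
    & forall c d, charts_for f c d ->
        loc_lipschitz_op (cran c) (fun z w =>
          s (cinv c z) ('d (cinv d) (local_rep f c d z) w) c)].

Definition eta f (c : R) (x0 : X) (rho : R) : \bar R :=
  ((c^-1)%:E * ereal_inf [set Sur f x | x in
                  [set x | (fdist N x0 x <= rho%:E)%E]])%E.

Definition varrho f (c : R) (x0 : X) (r : R) : \bar R :=
  (\int[lebesgue_measure]_(rho in `[0%R, r]) eta f c x0 rho)%E.

End maps.

Arguments charts_for {R X E F} M f c d.
Arguments C1_map {R X E F} M f.
Arguments loc_lipschitz_derivative {R X E F} M f.
Arguments submersion {R X E F} M f.

(* Main.v *)
(* Since df(x) s(x) = id, moving from x along s(x)(y - f x) decreases |y - f|
   at a rate close to 1 / |s(x)| per unit of length, which by assumption is at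
   least eta(rho) when d(x0, x) <= rho.  A point reached from x0 by such moves
   of total length l therefore satisfies
     |y - f x| <= |y - f x0| - (1 - eps) * (integral of eta over [0, l]),
   so that l stays below r.  As l is a bounded increasing Lyapunov function and
   X is complete, an Ekeland-type argument yields a state at which no further
   move is possible, i.e. a solution of f x = y in the ball of radius r.

   As [fdist] is an infimum over C^1 paths, paths that can be concatenated are
   needed: those which start and end with zero velocity, obtained from chart
   segments by a smoothstep reparametrization. *)

Require Import Defs.
From HB Require Import structures.
From mathcomp Require Import all_boot all_order all_algebra.
From mathcomp Require Import all_classical all_reals all_analysis.
From mathcomp Require Import measurable_realfun ring lra.
Import Order.TTheory GRing.Theory Num.Theory.
Import numFieldNormedType.Exports.
Local Open Scope classical_set_scope.
Local Open Scope ring_scope.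

Set Implicit Arguments.
Unset Strict Implicit.

(** The first-order remainder of g is small relative to |z s - z t|, and the quotients of z are
    eventually bounded by |w| + 1, so after division by s - t it tends to 0. A general filter [G]
    covers interior times and the one-sided limits at end points alike. *)
Lemma chain_quotient (R : realType) (V W : normedModType R) (G : set_system R)
    {FG : Filter G} (g : V -> W) (z : R -> V) (t : R) (w : V) :
  differentiable g (z t) -> z s @[s --> G] --> z t ->
  (s - t)^-1 *: (z s - z t) @[s --> G] --> w ->
  (s - t)^-1 *: (g (z s) - g (z t)) @[s --> G] --> 'd g (z t) w.
Proof.
move=> dg zt qw.
set q := fun s => (s - t)^-1 *: (z s - z t).
have dq : 'd g (z t) (q s) @[s --> G] --> 'd g (z t) w.
  by apply: continuous_cvg qw; exact: (diff_continuous dg).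
have r0 : (s - t)^-1 *: (g (z s) - g (z t)) - 'd g (z t) (q s) @[s --> G] --> 0.
  apply/cvgr0Pnorm_le => e e0.
  have w1 : 0 < `|w| + 1 by rewrite ltr_pwDr.
  have /diff_locallyP[_ /eqaddoP/(_ _ (divr_gt0 e0 w1))] := dg.
  move=> dgx.
  have {}dgx : \forall s \near G,
    `|g (z s) - g (z t) - 'd g (z t) (z s - z t)| <= e / (`|w| + 1) * `|z s - z t|.
    have : (z s - z t) @[s --> G] --> 0.
      by rewrite -(subrr (z t)); apply: cvgB => //; exact: cvg_cst.
    move=> /(_ _ dgx) zG; apply: (@filterS _ G FG _ _ _ zG) => s /=.
    by rewrite !fctE /= subrK opprD addrA.
  have qb : \forall s \near G, `|q s| < `|w| + 1.
    apply: (cvgr_lt `|w|) => //; last by rewrite ltrDl.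
    exact: (cvg_norm qw).
  near=> s.
  rewrite /q linearZ /= -scalerBr normrZ.
  have h1 : `|g (z s) - g (z t) - 'd g (z t) (z s - z t)| <=
      e / (`|w| + 1) * `|z s - z t| by near: s.
  have h2 : `|q s| < `|w| + 1 by near: s.
  apply: (le_trans (ler_wpM2l (normr_ge0 _) h1)).
  rewrite mulrCA -normrZ -/(q s).
  rewrite -[leRHS](divfK (lt0r_neq0 w1)).
  by apply: ler_wpM2l; [apply: divr_ge0|]; exact: ltW.
rewrite (_ : (fun s => _) = (fun s => 'd g (z t) (q s)) +
    (fun s => (s - t)^-1 *: (g (z s) - g (z t)) - 'd g (z t) (q s))).
  by rewrite -[X in _ --> X]addr0; exact: cvgD.
by apply/funext => s; rewrite !fctE addrC subrK.
Unshelve. all: by end_near. Qed.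

(** * Curves in charts *)

Section tangent_bundle.
Context {R : realType} {X : topologicalType} {E : completeNormedModType R}.
Variable M : C2manifold X E.
Implicit Types (c : chart X E) (x : X).

Lemma cinv_cran c z : cran c z -> cdom c (cinv c z) /\ cmap c (cinv c z) = z.
Proof. by move=> [x cx <-]; rewrite cmapK. Qed.

Lemma chart_at_cinv c z : atlas M c -> cran c z -> chart_at M (cinv c z) c.
Proof. by move=> Mc /cinv_cran[]. Qed.

Lemma nbhs_cran c z : cran c z -> \forall y \near z, cran c y.
Proof. by move=> cz; apply: open_nbhs_nbhs; split => //; exact: cran_open. Qed.

Lemma nbhs_cdom c x : cdom c x -> \forall y \near x, cdom c y.
Proof. by move=> cx; apply: open_nbhs_nbhs; split => //; exact: cdom_open. Qed.

Lemma cinv_continuous_at c z : cran c z -> {for z, continuous (cinv c)}.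
Proof.
have := @cinv_continuous _ _ _ c.
rewrite continuous_open_subspace; last exact: cran_open.
by move=> + cz => /(_ z); apply; rewrite inE.
Qed.

Lemma cmap_continuous_at c x : cdom c x -> {for x, continuous (cmap c)}.
Proof.
have := @cmap_continuous _ _ _ c.
rewrite continuous_open_subspace; last exact: cdom_open.
by move=> + cz => /(_ x); apply; rewrite inE.
Qed.

Lemma tb_eta (q : tbundle M) : TBundle (tb_vec q) = q.
Proof. by case: q. Qed.

Lemma tb_chart_continuous_at c (p : E * E) : atlas M c -> cran c p.1 ->
  {for p, continuous (tb_chart M c)}.
Proof.
move=> Mc cp A [B [oB Bp BA]].
have : nbhs p [set q : E * E | cran c q.1 /\ B (tb_chart M c q)].
  by apply: open_nbhs_nbhs; split; [exact: oB | split].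
by apply: filterS => q [_ /BA].
Qed.

Lemma tvec_linear c x : linear (tvec M c x).
Proof.
move=> a u v; apply: val_inj; apply/funext => d /=.
rewrite /tvec_coord [RHS]/= addrfctE scalrfctE /= /tvec_coord.
by case: asboolP => _; rewrite ?linearP// scaler0 addr0.
Qed.

HB.instance Definition _ c x :=
  GRing.isLinear.Build R E (tangent M x) _ (tvec M c x) (tvec_linear c x).

Lemma tvec_tcoord c x (v : tangent M x) : chart_at M x c ->
  tvec M c x (v c) = v.
Proof.
move=> cx; apply: val_inj; apply/funext => d /=; rewrite /tvec_coord.
have /asboolP[vE v0] := tangentP v.
case: asboolP => [[_ dx]|ncd]; first by rewrite (vE c d).
by rewrite v0// => dx; apply: ncd.
Qed.

(** A velocity has to be checked in every chart [d] at the point. The chain rule for the transition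
    map from [c] to [d] reduces this to the derivative of z in [c]. *)
Lemma chart_path c (z dz : R -> E) (a b : R) : atlas M c ->
  (forall t, t \in `[a, b] -> cran c (z t)) ->
  {within `[a, b], continuous z} -> {within `[a, b], continuous dz} ->
  (forall t, t \in `[a, b] ->
    (s - t)^-1 *: (z s - z t)
      @[s --> within [set s | s \in `[a, b] /\ s != t] (nbhs t)] --> dz t) ->
  C1_path a b (fun t => tb_vec (tb_chart M c (z t, dz t))).
Proof.
move=> Mc cz /subspace_continuousP zc /subspace_continuousP dzc dzE.
split => [|t tab d xd|].
- apply/subspace_continuousP => t tab /=.
  exact: cvg_comp (zc t tab) (cinv_continuous_at (cz t tab)).
- have cx := chart_at_cinv Mc (cz _ tab).
  have [_ czt] := cinv_cran (cz _ tab).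
  rewrite /= /tvec_coord; case: asboolP => [_|[]//].
  have dT := transition_differentiable cx xd; rewrite czt in dT *.
  apply: (chain_quotient dT _ (dzE t tab)).
  apply: cvg_trans (zc t tab); apply: cvg_app.
  by apply: within_subset => // s [].
- apply/subspace_continuousP => t tab /=.
  have -> : (fun s => TBundle (tvec M c (cinv c (z s)) (dz s))) =
    tb_chart M c \o (fun s => (z s, dz s)) by [].
  apply: (cvg_comp _ (tb_chart M c)); last first.
    by apply: (@tb_chart_continuous_at c (z t, dz t)) => //; exact: cz.
  by apply: cvg_pair; [exact: zc | exact: dzc].
Qed.

End tangent_bundle.

(** * Paths with zero velocity at both ends *)

Section smoothstep.
Context {R : realType}.
Implicit Types a s t : R.

(** The cubic Hermite step: it climbs from 0 to 1 on [0, 1] with zero slope at both ends. *)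
Definition smoothstep s : R := s ^+ 2 * (3 - 2 * s).
Definition dsmoothstep s : R := 6 * s * (1 - s).

Lemma is_derive_smoothstep K a t :
  is_derive t 1 (fun u => K * smoothstep (u - a)) (K * dsmoothstep (t - a)).
Proof.
rewrite (_ : (fun u => _) = cst K *
    ((id - cst a) * (id - cst a) * (cst 3 - cst 2 * (id - cst a))) :> (R -> R)).
  by apply: is_derive_eq; rewrite /dsmoothstep !fctE /= /GRing.scale /=; ring.
by apply/funext => u; rewrite /smoothstep !fctE /=; ring.
Qed.

Lemma smoothstep_continuous a : continuous (fun u => smoothstep (u - a)).
Proof.
move=> t; have h := is_derive_smoothstep 1 a t.
rewrite (_ : (fun u => _) = (fun u => 1 * smoothstep (u - a))).
  by apply: differentiable_continuous; apply/derivable1_diffP.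
by apply/funext => u; rewrite mul1r.
Qed.

Lemma dsmoothstep_continuous a : continuous (fun u => dsmoothstep (u - a)).
Proof.
move=> t; rewrite /dsmoothstep.
have cB : (u - a) @[u --> t] --> t - a.
  by apply: cvgB; [exact: cvg_id | exact: cvg_cst].
apply: cvgM; last by apply: cvgB => //; exact: cvg_cst.
by apply: cvgM => //; exact: cvg_cst.
Qed.

Lemma smoothstep0 : smoothstep 0 = 0.
Proof. by rewrite /smoothstep; ring. Qed.

Lemma smoothstep1 : smoothstep 1 = 1.
Proof. by rewrite /smoothstep; ring. Qed.

Lemma dsmoothstep0 : dsmoothstep 0 = 0.
Proof. by rewrite /dsmoothstep; ring. Qed.

Lemma dsmoothstep1 : dsmoothstep 1 = 0.
Proof. by rewrite /dsmoothstep; ring. Qed.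

Lemma smoothstep_itv s : 0 <= s <= 1 -> 0 <= smoothstep s <= 1.
Proof.
rewrite /smoothstep => /andP[s0 s1]; apply/andP; split.
  by rewrite mulr_ge0 ?sqr_ge0//; lra.
rewrite -subr_ge0 (_ : 1 - _ = (1 - s) ^+ 2 * (1 + 2 * s)); last by ring.
by rewrite mulr_ge0 ?sqr_ge0//; lra.
Qed.

Lemma dsmoothstep_ge0 s : 0 <= s <= 1 -> 0 <= dsmoothstep s.
Proof. rewrite /dsmoothstep => /andP[s0 s1]; nra. Qed.

Lemma integral_dsmoothstep K a :
  (\int[lebesgue_measure]_(t in `[a, (a + 1)%R]) (K * dsmoothstep (t - a))%:E)%E
  = K%:E.
Proof.
rewrite (@continuous_FTC2 _ _ (fun u => K * smoothstep (u - a))).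
- rewrite -EFinB; congr (_%:E).
  by rewrite addrAC subrr add0r smoothstep0 smoothstep1; ring.
- by rewrite ltrDl.
- apply: continuous_subspaceT => t.
  by apply: cvgM; [exact: cvg_cst | exact: dsmoothstep_continuous].
- have c u : (K * smoothstep (v - a)) @[v --> u] --> K * smoothstep (u - a).
    by apply: cvgM; [exact: cvg_cst | exact: smoothstep_continuous].
  split.
  + by move=> u _; have := is_derive_smoothstep K a u => ?.
  + by apply: cvg_within_filter; exact: c.
  + by apply: cvg_within_filter; exact: c.
- move=> u _; rewrite derive1E.
  by have /@derive_val := is_derive_smoothstep K a u.
Qed.

End smoothstep.

Section paths.
Context {R : realType} {X : topologicalType} {E : completeNormedModType R}.
Context {M : C2manifold X E}.
Variable N : finsler M.
Implicit Types (c : chart X E) (x y : X) (p : R -> tbundle M).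

Lemma speed_continuous (a b : R) (alpha : R -> X)
    (v : forall t, tangent M (alpha t)) :
  C1_path a b v -> {within `[a, b], continuous (fun t => fnorm N (v t))}.
Proof.
move=> [_ _ /subspace_continuousP vc]; apply/subspace_continuousP => t tab.
exact: cvg_comp (vc t tab) (@fnorm_continuous _ _ _ _ N (TBundle (v t))).
Qed.

Lemma speed_measurable (a b : R) (alpha : R -> X)
    (v : forall t, tangent M (alpha t)) :
  C1_path a b v -> measurable_fun `[a, b] (fun t => tnorm N (v t)).
Proof.
move=> /speed_continuous vc; apply/measurable_EFinP.
exact: subspace_continuous_measurable_fun.
Qed.

Definition rest x : tbundle M := TBundle (0 : tangent M x).

Definition rest_path (a b : R) p x y (l : R) :=
  [/\ C1_path a b (fun t => tb_vec (p t)), p a = rest x, p b = rest y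
    & (\int[lebesgue_measure]_(t in `[a, b]) tnorm N (tb_vec (p t))
        <= l%:E)%E].

(** The segment is run through with velocity [dsmoothstep (t - a) *: w], of norm at most K times
    [dsmoothstep (t - a)]. The integral of this bound is K, and the velocity vanishes at both
    ends. *)
Lemma segment_path c (z w : E) (a K : R) : atlas M c ->
  (forall tau, 0 <= tau <= 1 -> cran c (z + tau *: w) /\
     fnorm N (tvec M c (cinv c (z + tau *: w)) w) <= K) ->
  exists p, rest_path a (a + 1) p (cinv c z) (cinv c (z + w)) K.
Proof.
move=> Mc segK.
exists (fun t => tb_chart M c
  (z + smoothstep (t - a) *: w, dsmoothstep (t - a) *: w)).
have tE (t : R) : `[a, (a + 1)%R]%classic t -> 0 <= t - a <= 1.
  by rewrite /= in_itv /= => /andP[? ?]; apply/andP; split; lra.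
have C1 : C1_path a (a + 1) (fun t => tb_vec (tb_chart M c
    (z + smoothstep (t - a) *: w, dsmoothstep (t - a) *: w))).
  apply: chart_path => //.
  - by move=> t /tE /smoothstep_itv /segK[].
  - apply: continuous_subspaceT => t; apply: cvgD; first exact: cvg_cst.
    by apply: cvgZ; [exact: smoothstep_continuous | exact: cvg_cst].
  - apply: continuous_subspaceT => t.
    by apply: cvgZ; [exact: dsmoothstep_continuous | exact: cvg_cst].
  - move=> t _; set G := within _ _.
    have FG : Filter G by exact: within_filter.
    (* P s is the difference quotient of [smoothstep] between t - a and s - a after division of
       polynomials; it is continuous in s, with value [dsmoothstep (t - a)] at s = t. *)
    pose P (s : R) := 3 * ((s - a) + (t - a)) -
      2 * ((s - a) ^+ 2 + (s - a) * (t - a) + (t - a) ^+ 2).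
    have Pc : P s *: w @[s --> G] --> dsmoothstep (t - a) *: w.
      have -> : dsmoothstep (t - a) = P t by rewrite /P /dsmoothstep; ring.
      apply: cvg_within_filter; apply: cvgZ; last exact: cvg_cst.
      have cB : (s - a) @[s --> t] --> t - a.
        by apply: cvgB; [exact: cvg_id | exact: cvg_cst].
      apply: cvgB; apply: cvgM; try exact: cvg_cst.
        by apply: cvgD => //; exact: cvg_cst.
      apply: cvgD; last exact: cvg_cst.
      apply: cvgD; last by apply: cvgM => //; exact: cvg_cst.
      by under eq_fun do rewrite expr2; rewrite expr2; apply: cvgM.
    apply: cvg_trans Pc; apply: near_eq_cvg.
    apply: filterS (@withinT _ _ _ _) => s [_ st].
    rewrite opprD addrACA subrr add0r -scalerBl scalerA; congr (_ *: w).
    by rewrite /P /smoothstep; field; rewrite subr_eq0.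
split => //.
- rewrite subrr smoothstep0 dsmoothstep0 !scale0r addr0.
  by congr TBundle; exact: linear0.
- rewrite addrAC subrr add0r smoothstep1 dsmoothstep1 scale0r scale1r.
  by congr TBundle; exact: linear0.
- rewrite -(integral_dsmoothstep K a); apply: ge0_le_integral => //.
  + by move=> t _; rewrite /tnorm lee_fin fnorm_ge0.
  + exact: speed_measurable.
  + apply/measurable_EFinP; apply: subspace_continuous_measurable_fun => //.
    apply: continuous_subspaceT => t.
    by apply: cvgM; [exact: cvg_cst | exact: dsmoothstep_continuous].
  + move=> t /tE ta; rewrite /tnorm lee_fin /= linearZ /= fnormZ mulrC.
    rewrite ger0_norm ?dsmoothstep_ge0//.
    by rewrite ler_wpM2r ?dsmoothstep_ge0//; case: (segK _ (smoothstep_itv ta)).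
Qed.

End paths.

(** * Concatenation of rest paths, and points joined by them *)

Section joined.
Context {R : realType} {X : topologicalType} {E : completeNormedModType R}.
Context {M : C2manifold X E}.
Variable N : finsler M.
Implicit Types (c : chart X E) (x y : X) (p q r : R -> tbundle M) (a b : R).

Local Notation C1_curve a b p := (C1_path a b (fun t => tb_vec (p t))).

Lemma fnormN x (v : tangent M x) : fnorm N (- v) = fnorm N v.
Proof. by rewrite -scaleN1r fnormZ normrN1 mul1r. Qed.

Lemma fnorm0 x : fnorm N (0 : tangent M x) = 0.
Proof. by rewrite -(scale0r (0 : tangent M x)) fnormZ normr0 mul0r. Qed.

(** If t lies outside the closed interval [a, b], so do all nearby times and the claim is vacuous.
    Hence it can be invoked for both pieces of a concatenation at every t, without a case
    distinction on the junction. *)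
Lemma C1_curve_velocity_eq a b p r c t (A : set E) : C1_curve a b p ->
  {in `[a, b], r =1 p} -> chart_at M (tb_base (r t)) c ->
  nbhs (tb_vec (r t) c) A ->
  \forall s \near t, s \in `[a, b] -> s != t ->
    A ((s - t)^-1 *: (cmap c (tb_base (r s)) - cmap c (tb_base (r t)))).
Proof.
move=> [_ pv _] rp cr Ac.
have [tab|tab] := boolP (t \in `[a, b]).
  rewrite rp// in cr Ac *.
  have pA : \forall s \near t, s \in `[a, b] /\ s != t ->
    A ((s - t)^-1 *: (cmap c (tb_base (p s)) - cmap c (tb_base (p t)))).
    exact: pv t tab c cr A Ac.
  by apply: filterS pA => s /= sA sab st; rewrite rp//; exact: sA.
have : nbhs t (~` `[a, b]%classic).
  apply: open_nbhs_nbhs; split; last by move=> /=; apply/negP.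
  by rewrite openC; exact: itv_closed.
by apply: filterS => s /= nab ab; rewrite ab in nab.
Qed.

Lemma C1_curve_cat a b b' p q r : a < b -> b < b' ->
  C1_curve a b p -> C1_curve b b' q ->
  {in `[a, b], r =1 p} -> {in `[b, b'], r =1 q} -> C1_curve a b' r.
Proof.
move=> ab bb' Cp Cq rp rq.
have abb' : `[a, b']%classic = `[a, b]%classic `|` `[b, b']%classic.
  apply/seteqP; split => t /=; rewrite !in_itv /=.
    by move=> /andP[at_ tb]; case: (leP t b) => tb1; [left|right]; lra.
  by case=> /andP[? ?]; apply/andP; split; lra.
(* Generic in g: it serves once with [tb_base] for the curve itself and once with the identity for
   its velocity. *)
have cat (U : topologicalType) (g : tbundle M -> U) :
    {within `[a, b], continuous (g \o p)} ->
    {within `[b, b'], continuous (g \o q)} ->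
    {within `[a, b'], continuous (g \o r)}.
  move=> gp gq; rewrite abb'.
  apply: withinU_continuous; [exact: itv_closed|exact: itv_closed| |].
    apply: (@subspace_eq_continuous _ _ _ (g \o p)) gp => t.
    by rewrite inE => tab; rewrite /from_subspace /= rp.
  apply: (@subspace_eq_continuous _ _ _ (g \o q)) gq => t.
  by rewrite inE => tab; rewrite /from_subspace /= rq.
split.
- by apply: (cat _ (@tb_base _ _ _ M)); [case: Cp|case: Cq].
- move=> t _ c cr A Ac.
  have := C1_curve_velocity_eq Cq rq cr Ac.
  have := C1_curve_velocity_eq Cp rp cr Ac.
  move=> h1 h2; suff : \forall s \near t, s \in `[a, b'] /\ s != t ->
    A ((s - t)^-1 *: (cmap c (tb_base (r s)) - cmap c (tb_base (r t)))) by [].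
  apply: filterS2 h1 h2 => s h1 h2 [].
  rewrite !in_itv /= => /andP[as_ sb] st; case: (leP s b) => sb1.
    by apply: h1 => //; rewrite in_itv /= as_.
  by apply: h2 => //; rewrite in_itv /= sb ltW.
- rewrite (_ : (fun t => TBundle _) = id \o r); last first.
    by apply/funext => t; exact: tb_eta.
  have tbE p' : (fun t => TBundle (tb_vec (p' t))) = id \o p'.
    by apply/funext => t; exact: tb_eta.
  by apply: cat; rewrite -tbE; [case: Cp|case: Cq].
Qed.

Lemma rest_path_cat a b b' p q x y z (l l' : R) : a < b -> b < b' ->
  rest_path N a b p x y l -> rest_path N b b' q y z l' ->
  exists r, rest_path N a b' r x z (l + l').
Proof.
move=> ab bb' [Cp pa pb pl] [Cq qb qb' ql].
(* At t = b the value comes from p; it agrees with q b because both are the zero vector at y. *)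
pose r t := if t <= b then p t else q t.
have rp : {in `[a, b], r =1 p}.
  by move=> t; rewrite in_itv /= /r => /andP[_ ->].
have rq : {in `[b, b'], r =1 q}.
  move=> t; rewrite in_itv /= /r => /andP[bt _].
  by case: (leP t b) => // tb; rewrite (_ : t = b) ?pb//; apply: le_anti; rewrite tb.
have Cr := C1_curve_cat ab bb' Cp Cq rp rq.
exists r; split => //.
- by rewrite rp// in_itv /= lexx ltW.
- by rewrite rq// in_itv /= lexx ltW.
have n0 (s : tbundle M) : (0 <= tnorm N (tb_vec s))%E.
  by rewrite /tnorm lee_fin fnorm_ge0.
(* The second interval is now open at b, so that the union is disjoint and the integral is
   additive. *)
have abb' : `[a, b']%classic = `[a, b]%classic `|` `]b, b']%classic.
  apply/seteqP; split => t /=; rewrite !in_itv /=.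
    by move=> /andP[at_ tb]; case: (leP t b) => tb1; [left|right]; lra.
  by case=> /andP[? ?]; apply/andP; split; lra.
rewrite abb' ge0_integral_setU//=.
- rewrite EFinD leeD//.
    apply: le_trans pl; rewrite le_eqVlt; apply/orP; left; apply/eqP.
    by apply: eq_integral => t; rewrite inE => /= tab; rewrite rp.
  apply: le_trans ql.
  apply: (@le_trans _ _ (\int[lebesgue_measure]_(t in `]b, b'])
      tnorm N (tb_vec (q t)))%E).
    rewrite le_eqVlt; apply/orP; left; apply/eqP.
    apply: eq_integral => t; rewrite inE => /= tab; rewrite rq//.
    by move: tab; rewrite !in_itv /= => /andP[/ltW -> ->].
  apply: ge0_subset_integral => //; first exact: speed_measurable.
  exact: subset_itv_oc_cc.
- by rewrite -abb'; exact: (speed_measurable N Cr).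
- rewrite disj_set2E; apply/eqP/seteqP; split => // t [] /=.
  by rewrite !in_itv /= => /andP[_ tb] /andP[bt _]; lra.
Qed.

(* The initial time is arbitrary, so that paths can be concatenated without
   reparametrization; the zero velocities at both ends make the concatenation
   of class C^1. *)
Definition arc x y (l : R) :=
  forall a, exists b, a < b /\ exists p, rest_path N a b p x y l.

(** Arcs in both directions are recorded, which makes the relation symmetric without reversing time
    along a path. *)
Definition joined x y l := arc x y l /\ arc y x l.

Lemma joined_sym x y l : joined x y l -> joined y x l.
Proof. by case. Qed.

Lemma arc_trans y x z l l' : arc x y l -> arc y z l' -> arc x z (l + l').
Proof.
move=> xy yz a; have [b [ab [p Pp]]] := xy a.
have [b' [bb' [q Pq]]] := yz b.
by exists b'; split; [exact: lt_trans bb'|exact: rest_path_cat Pp Pq].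
Qed.

Lemma joined_trans y x z l l' :
  joined x y l -> joined y z l' -> joined x z (l + l').
Proof.
move=> [xy yx] [yz zy]; split; first exact: arc_trans yz.
by rewrite addrC; exact: arc_trans yx.
Qed.

Lemma joined_le x y l l' : l <= l' -> joined x y l -> joined x y l'.
Proof.
move=> ll' [xy yx]; split => a.
  have [b [ab [p [? ? ? pl]]]] := xy a; exists b; split => //; exists p.
  by split => //; apply: le_trans pl _; rewrite lee_fin.
have [b [ab [p [? ? ? pl]]]] := yx a; exists b; split => //; exists p.
by split => //; apply: le_trans pl _; rewrite lee_fin.
Qed.

Lemma joined_fdist x y l : joined x y l -> (fdist N x y <= l%:E)%E.
Proof.
move=> [/(_ 0)[b [b0 [p [Cp pa pb pl]]]] _]; apply: le_trans pl.
apply: ereal_inf_lbound.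
exists 0, b, (fun t => tb_base (p t)), (fun t => tb_vec (p t)).
by split => //; rewrite ?pa ?pb.
Qed.

(** The return arc is the segment from z + w along - w: its point at tau is the point of the given
    segment at 1 - tau, and the norm ignores the sign. *)
Lemma joined_segment c (z w : E) (K : R) : atlas M c ->
  (forall tau, 0 <= tau <= 1 -> cran c (z + tau *: w) /\
     fnorm N (tvec M c (cinv c (z + tau *: w)) w) <= K) ->
  joined (cinv c z) (cinv c (z + w)) K.
Proof.
move=> Mc segK; split=> a; exists (a + 1); rewrite ltrDl ltr01; split => //.
  exact: segment_path.
have [|p] := @segment_path _ _ _ _ N c (z + w) (- w) a K Mc; last first.
  by rewrite addrK; exists p.
move=> tau /andP[tau0 tau1].
have -> : z + w + tau *: - w = z + (1 - tau) *: w.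
  by rewrite scalerN scalerBl scale1r addrA.
have [|? ?] := segK (1 - tau); first by apply/andP; split; lra.
by split => //; rewrite linearN /= fnormN.
Qed.

Lemma joined_refl x : joined x x 0.
Proof.
have [c [Mc cx]] := atlas_cover M x.
have := @joined_segment c (cmap c x) 0 0 Mc.
rewrite addr0 cmapK//; apply => tau _; rewrite scaler0 addr0.
split; first by exists x.
by rewrite linear0 fnorm0.
Qed.

End joined.

(** * A mean value inequality *)

Section real_line.
Context {R : realType}.
Local Notation mu := (@lebesgue_measure R).

Lemma Rintegral_itv_bounds (f : R -> R) (a b s t m k : R) :
  mu.-integrable `[a, b] (EFin \o f) -> a <= s -> s <= t -> t <= b ->
  (forall u, s < u <= t -> m <= f u <= k) ->
  m * (t - s) <= \int[mu]_(u in `[a, t]) f u - \int[mu]_(u in `[a, s]) f u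
    <= k * (t - s).
Proof.
move=> intf as_ st tb fb.
have intt : mu.-integrable `[a, t] (EFin \o f).
  apply: integrableS intf => //; exact: subset_itvl.
rewrite Rintegral_itvB//.
have ints : mu.-integrable `]s, t] (EFin \o f).
  apply: integrableS intt => //; apply: subset_itvr.
  by rewrite bnd_simp.
have intc (r : R) : mu.-integrable `]s, t] (EFin \o cst r).
  have : mu.-integrable `[s, t] (EFin \o cst r).
    apply: continuous_compact_integrable; first exact: segment_compact.
    by apply: continuous_subspaceT => x; exact: cvg_cst.
  by apply: integrableS => //; exact: subset_itv_oc_cc.
have cE (r : R) : r * (t - s) = \int[mu]_(u in `]s, t]) cst r u.
  rewrite Rintegral_cst//; congr (_ * _).
  rewrite -[LHS]/(fine (t - s)%:E); congr fine; apply/esym.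
  rewrite [LHS]lebesgue_measure_itv /= lte_fin -EFinB.
  by case: ltgtP st => // -> _; rewrite subrr.
by rewrite !cE; apply/andP; split; apply: le_Rintegral => // u /=;
  rewrite in_itv /= => /fb /andP[].
Qed.

Lemma near_right_le (g : R -> R) (a b t e : R) :
  {within `[a, b], continuous g} -> a <= t -> t < b -> 0 < e ->
  \forall s \near t^'+, s <= b /\ forall u, t <= u <= s -> `|g t - g u| <= e.
Proof.
move=> /subspace_continuousP gc at_ tb e0.
have tab : `[a, b]%classic t by rewrite /= in_itv /= at_ ltW.
have /cvgrPdist_le/(_ e e0) := gc t tab.
rewrite near_withinE => /nbhs_ballP[d /= d0 gd].
near=> s.
have sb : s <= b by near: s; exact: nbhs_right_ltW.
have sd : s < t + d by near: s; apply: nbhs_right_lt; rewrite ltrDl.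
split => // u /andP[tu us]; apply: gd.
  rewrite /ball /= distrC ger0_norm ?subr_ge0//; lra.
rewrite /= in_itv /=; apply/andP; split; lra.
Unshelve. all: by end_near. Qed.

(* [phi] need be neither continuous nor differentiable: its increments only
   have to dominate those of [beta] to first order from the right. *)
Lemma mean_value_le (V : normedModType R) (beta : R -> V) (phi : R -> R)
    (a b : R) : a <= b -> {within `[a, b], continuous beta} ->
  (forall s t, a <= s -> s <= t -> t <= b -> phi s <= phi t) ->
  (forall t e, a <= t -> t < b -> 0 < e -> \forall s \near t^'+,
     `|beta s - beta t| <= phi s - phi t + e * (s - t)) ->
  `|beta b - beta a| <= phi b - phi a.
Proof.
move=> ab /subspace_continuousP bc phile loc.
apply/ler_addgt0Pr => e' e'0.
have ba1 : 0 < b - a + 1 by rewrite ltr_wpDl ?subr_ge0.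
(* The slack accumulated over [a, b] is e * (b - a) <= e'; the added 1 keeps the denominator
   positive when a = b. *)
pose e := e' / (b - a + 1).
have e0 : 0 < e by rewrite divr_gt0.
pose A := [set t | a <= t <= b /\
  `|beta t - beta a| <= phi t - phi a + e * (t - a)].
have Aa : A a by rewrite /A /= lexx ab !subrr normr0 mulr0 addr0.
have supA : has_sup A by split; [exists a | exists b => t [/andP[]]].
have Ale t : A t -> t <= sup A by move=> At; exact: ub_le_sup supA.2 _ At.
set c := sup A.
have ac : a <= c by exact: Ale.
have cb : c <= b by apply: ge_sup; [exists a | move=> t [/andP[]]].
(* The supremum belongs to A: [beta] is continuous, and [phi], being nondecreasing, can only gain
   when passing from t up to c. *)
have Ac : A c.
  split; first by rewrite ac.
  apply/ler_addgt0Pr => d d0.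
  have cab : `[a, b]%classic c by rewrite /= in_itv /= ac.
  have /cvgrPdist_le/(_ d d0) := bc c cab.
  rewrite near_withinE => /nbhs_ballP[k /= k0 bk].
  have [t At ct] := sup_adherent k0 supA.
  have tc := Ale _ At; have [/andP[at_ tb] bt] := At.
  have : `|beta c - beta t| <= d.
    apply: bk; rewrite /ball /= ?in_itv /= ?at_//.
    by rewrite ger0_norm ?subr_ge0//; rewrite -/c in ct tc *; lra.
  have := phile t c at_ tc cb.
  have : e * (t - a) <= e * (c - a).
    by apply: ler_wpM2l; [exact: ltW | rewrite lerD2r].
  have := ler_distD (beta t) (beta c) (beta a); lra.
have -> : b = c.
  (* If c < b, the first-order estimate at c produces a point of A to the right of c. *)
  apply/eqP; rewrite eq_le cb andbT leNgt; apply/negP => {}cb.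
  have [s [bs cs sb]] : exists s,
      [/\ `|beta s - beta c| <= phi s - phi c + e * (s - c), c < s & s < b].
    apply: (@filter_ex _ c^'+); near=> s; split; near: s.
    - exact: loc.
    - exact: nbhs_right_gt.
    - exact: nbhs_right_lt.
  have : A s.
    split; first by apply/andP; split; lra.
    have := ler_distD (beta c) (beta s) (beta a); case: Ac => _.
    by rewrite !mulrBr in bs *; lra.
  by move=> /Ale; rewrite -/c; lra.
case: Ac => _ /le_trans; apply; rewrite lerD2l.
rewrite -[leRHS](divfK (lt0r_neq0 ba1)) -/e; apply: ler_wpM2l; [exact: ltW | lra].
Unshelve. all: by end_near. Qed.

End real_line.

(** * Comparison of the Finsler distance with the topology *)

Section finsler_topology.
Context {R : realType} {X : topologicalType} {E : completeNormedModType R}.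
Context {M : C2manifold X E}.
Variable N : finsler M.
Implicit Types (c : chart X E) (x y : X).
Local Notation mu := (@lebesgue_measure R).

(** The Palais condition with constant 2 carries the equivalence of norms at x over to the whole
    domain of the chart that it provides. *)
Lemma chart_norm_equiv x : exists c m k, [/\ chart_at M x c, 0 < m, 0 < k &
  forall y, cdom c y -> forall w : E,
    m * `|w| <= fnorm N (tvec M c y w) <= k * `|w|].
Proof.
have [c cx palais] := @fnorm_palais _ _ _ _ N x 2 (ltr1n R 2).
have [m [k [m0 k0 mk]]] := fnorm_equiv N cx.
exists c, (m / 2), (2 * k); split; [by []|lra|lra|].
move=> y cy w; have /andP[h1 h2] := palais y cy w; have /andP[h3 h4] := mk w.
apply/andP; split.
  apply: le_trans h1; rewrite mulrAC [leRHS]mulrC ler_wpM2r//; lra.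
by apply: (le_trans h2); rewrite -mulrA ler_wpM2l.
Qed.

(** For y close to x the chart segment from y to x stays in a ball inside the image of the chart,
    and its Finsler length is at most k times its length in the chart. *)
Lemma joined_near x (e : R) : 0 < e -> \forall y \near x, joined N y x e.
Proof.
move=> e0; have [c [m [k [cx m0 k0 mk]]]] := chart_norm_equiv x.
have [Mc xc] := cx.
have cran_x : cran c (cmap c x) by exists x.
have /nbhs_ballP[d /= d0 dc] := nbhs_cran cran_x.
near=> y.
have cy : cdom c y by near: y; exact: nbhs_cdom.
have [yd ye] : `|cmap c x - cmap c y| < d /\ `|cmap c x - cmap c y| < e / k.
  near: y; have /cvgrPdist_lt cc := cmap_continuous_at xc.
  by apply: filterI; apply: cc => //; rewrite divr_gt0.
rewrite -(cmapK cy) -(cmapK xc) -[cmap c x](subrK (cmap c y)) addrC.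
apply: joined_segment => // tau /andP[tau0 tau1].
have cz : cran c (cmap c y + tau *: (cmap c x - cmap c y)).
  apply: dc; rewrite -ball_normE /ball_ /= opprD addrA.
  rewrite -[X in X - _]scale1r -scalerBl normrZ ger0_norm; last lra.
  apply: le_lt_trans yd; rewrite ler_piMl//; lra.
split => //; have [cq _] := cinv_cran cz.
have /andP[_ /le_trans] := mk _ cq (cmap c x - cmap c y); apply.
by rewrite mulrC -ler_pdivlMr// ltW.
Unshelve. all: by end_near. Qed.

(** The coordinate velocity is bounded by the speed divided by m. So [mean_value_le] applies with
    [phi] the arc length divided by m. *)
Lemma curve_chart_le (a b : R) (alpha : R -> X)
    (v : forall t, tangent M (alpha t)) c (m s t : R) :
  C1_path a b v -> atlas M c -> 0 < m ->
  (forall y, cdom c y -> forall w : E, m * `|w| <= fnorm N (tvec M c y w)) ->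
  a <= s -> s <= t -> t <= b -> (forall u, s <= u <= t -> cdom c (alpha u)) ->
  m * `|cmap c (alpha t) - cmap c (alpha s)| <=
    \int[mu]_(u in `[a, t]) fnorm N (v u) -
    \int[mu]_(u in `[a, s]) fnorm N (v u).
Proof.
move=> Cv Mc m0 mc as_ st tb dom.
have gc := speed_continuous (N := N) Cv; have [ac vd _] := Cv.
set g := fun u => fnorm N (v u).
have gint : mu.-integrable `[a, b] (EFin \o g).
  by apply: continuous_compact_integrable; [exact: segment_compact|exact: gc].
pose phi t := m^-1 * \int[mu]_(u in `[a, t]) g u.
rewrite -ler_pdivlMl// mulrBr -/(phi t) -/(phi s).
apply: (@mean_value_le _ _ (cmap c \o alpha) phi) => //.
- apply/subspace_continuousP => u usv.
  have uab : `[a, b]%classic u.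
    by move: usv; rewrite /= !in_itv /= => /andP[? ?]; apply/andP; split; lra.
  have cu : cdom c (alpha u) by apply: dom; move: usv; rewrite /= in_itv.
  move/subspace_continuousP: ac => /(_ u uab) ac.
  have acc : (cmap c \o alpha) r @[r --> within `[a, b] (nbhs u)] -->
      cmap c (alpha u).
    exact: cvg_comp ac (cmap_continuous_at cu).
  apply: cvg_trans acc; apply: cvg_app; apply: within_subset => //.
  by move=> r /=; rewrite !in_itv /= => /andP[? ?]; apply/andP; split; lra.
- move=> u u' su uu' u't; rewrite /phi ler_pM2l ?invr_gt0// -subr_ge0.
  rewrite Rintegral_itvB//.
  + by apply: Rintegral_ge0 => r _; exact: fnorm_ge0.
  + apply: integrableS gint => //; apply: subset_itvl; rewrite bnd_simp; lra.
  + rewrite bnd_simp; lra.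
- move=> u e su ut e0.
  have au : a <= u by lra.
  have ub : u < b by lra.
  have uab : u \in `[a, b] by rewrite in_itv /=; apply/andP; split; lra.
  have cu : chart_at M (alpha u) c.
    by split => //; apply: dom; apply/andP; split; lra.
  (* Half of e pays for the difference quotient of the curve and half for the variation of the
     speed; the latter tolerance is m * e1 because [phi] divides by m. *)
  pose e1 := e / 2; have e10 : 0 < e1 by rewrite divr_gt0.
  have e2m : 0 < m * e1 by rewrite mulr_gt0.
  have /cvg_norm/cvgrPdist_le/(_ _ e10) := vd u uab c cu.
  rewrite near_withinE => vde.
  have {}vde : \forall r \near u^'+, r <= b ->
      `| `|v u c| - `|(r - u)^-1 *: (cmap c (alpha r) - cmap c (alpha u))| | <= e1.
    rewrite near_withinE; apply: filterS vde => r h ur rb; apply: h.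
    rewrite /= in_itv /=; split; last by rewrite gt_eqF.
    by apply/andP; split => //; exact: le_trans (ltW ur).
  near=> r.
  have ur : u < r by near: r; exact: nbhs_right_gt.
  have [rb gr] : r <= b /\ forall w, u <= w <= r -> `|g u - g w| <= m * e1.
    by near: r; exact: near_right_le gc au ub e2m.
  have vr : `| `|v u c| -
      `|(r - u)^-1 *: (cmap c (alpha r) - cmap c (alpha u))| | <= e1.
    by move: rb; near: r.
  have ru : 0 < r - u by rewrite subr_gt0.
  have bb : `|cmap c (alpha r) - cmap c (alpha u)| <= (r - u) * (m^-1 * g u + e1).
    rewrite -ler_pdivrMl//.
    rewrite -[X in X * _](@ger0_norm _ (r - u)^-1) ?invr_ge0; last exact: ltW.
    rewrite -normrZ.
    have : `|v u c| <= m^-1 * g u.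
      rewrite ler_pdivlMl//; have [_ du] := cu.
      by have := mc _ du (v u c); rewrite tvec_tcoord.
    by move: vr; rewrite ler_distl => /andP[+ _]; lra.
  have /andP[ib _] : (g u - m * e1) * (r - u) <= \int[mu]_(w in `[a, r]) g w -
     \int[mu]_(w in `[a, u]) g w <= (g u + m * e1) * (r - u).
    apply: (Rintegral_itv_bounds gint); [by []|exact: ltW|by []|].
    move=> w /andP[uw wr]; have := gr w; rewrite (ltW uw) wr => /(_ isT).
    by rewrite ler_distl => /andP[? ?]; apply/andP; split; lra.
  apply: (le_trans bb); rewrite /phi -mulrBr.
  have : m^-1 * ((g u - m * e1) * (r - u)) <= m^-1 * (\int[mu]_(w in `[a, r]) g w -
     \int[mu]_(w in `[a, u]) g w) by rewrite ler_wpM2l// invr_ge0 ltW.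
  have -> : m^-1 * ((g u - m * e1) * (r - u)) = (r - u) * (m^-1 * g u - e1).
    by field; lra.
  have -> : (r - u) * (m^-1 * g u + e1) = (r - u) * (m^-1 * g u - e1) + e * (r - u).
    by rewrite /e1; field; lra.
  by move=> h; rewrite lerD2r.
Unshelve. all: by end_near. Qed.

End finsler_topology.

Section fdist_topology.
Context {R : realType} {X : topologicalType} {E : completeNormedModType R}.
Context {M : C2manifold X E}.
Variable N : finsler M.
Implicit Types (c : chart X E) (x y : X).
Local Notation mu := (@lebesgue_measure R).

(* The limit of the curve at the supremum t0 of the times spent outside a
   chart ball is computed in the chart, where the curve is Cauchy; it lies in
   the ball, and it is alpha t0 since the manifold is Hausdorff. *)
Lemma short_curve_in_ball (a b : R) (alpha : R -> X)
    (v : forall t, tangent M (alpha t)) c (m d : R) :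
  a < b -> C1_path a b v -> chart_at M (alpha b) c -> 0 < m ->
  (forall y, cdom c y -> forall w : E, m * `|w| <= fnorm N (tvec M c y w)) ->
  (forall z, `|cmap c (alpha b) - z| < d -> cran c z) ->
  \int[mu]_(u in `[a, b]) fnorm N (v u) < m * d ->
  cdom c (alpha a) /\ `|cmap c (alpha b) - cmap c (alpha a)| < d.
Proof.
move=> ab Cv [Mc cb] m0 mc ballc short.
have gc := speed_continuous (N := N) Cv; have [/subspace_continuousP ac _ _] := Cv.
set g := fun u => fnorm N (v u).
have gint : mu.-integrable `[a, b] (EFin \o g).
  by apply: continuous_compact_integrable; [exact: segment_compact|exact: gc].
pose phi t := \int[mu]_(u in `[a, t]) g u.
pose V := [set y | cdom c y /\ `|cmap c (alpha b) - cmap c y| < d].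
have V_nbhs y : V y -> nbhs y V.
  move=> [cy yd]; apply: filterI; first exact: nbhs_cdom.
  have dy : 0 < d - `|cmap c (alpha b) - cmap c y| by rewrite subr_gt0.
  have /cvgrPdist_lt/(_ _ dy) := cmap_continuous_at cy.
  apply: filterS => y' yy' /=.
  have := ler_distD (cmap c y) (cmap c (alpha b)) (cmap c y'); lra.
have d0 : 0 < d.
  have : 0 <= phi b by apply: Rintegral_ge0 => u _; exact: fnorm_ge0.
  by move=> /le_lt_trans/(_ short); rewrite pmulr_rgt0.
have Vb : V (alpha b) by split => //; rewrite subrr normr0.
suff : V (alpha a) by [].
apply: contrapT => nVa.
pose B := [set t | t \in `[a, b] /\ ~ V (alpha t)].
have Ba : B a by split => //; rewrite in_itv /= lexx ltW.
have supB : has_sup B.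
  by split; [exists a | exists b => t []; rewrite in_itv /= => /andP[]].
have Ble t : B t -> t <= sup B by move=> Bt; exact: ub_le_sup supB.2 _ Bt.
set t0 := sup B in Ble.
have at0 : a <= t0 by exact: Ble.
have t0b : t0 <= b.
  by apply: ge_sup; [exists a | move=> t []; rewrite in_itv /= => /andP[]].
have t0ab : `[a, b]%classic t0 by rewrite /= in_itv /= at0.
(* V is open, so the supremum t0 of the times spent outside V is itself such a time. *)
have nVt0 : ~ V (alpha t0).
  move=> /V_nbhs Vt0.
  have : \forall t \near t0, t \in `[a, b] -> V (alpha t) by exact: ac t0 t0ab _ Vt0.
  move=> /nbhs_ballP[k /= k0 kV].
  have [t Bt t0t] := sup_adherent k0 supB.
  have tt0 := Ble _ Bt; have [tab] := Bt; apply; apply: kV => //.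
  by rewrite /ball /= ger0_norm ?subr_ge0//; rewrite -/t0 in t0t; lra.
have {}t0b : t0 < b.
  by rewrite lt_neqAle t0b andbT; apply/eqP => t0b'; apply: nVt0; rewrite t0b'.
have domV t : t0 < t -> t <= b -> V (alpha t).
  move=> t0t tb; apply: contrapT => nV; have : B t.
    by split => //; rewrite in_itv /= tb andbT; lra.
  by move=> /Ble; lra.
pose beta t := cmap c (alpha t).
have bl s t : t0 < s -> s <= t -> t <= b ->
    `|beta t - beta s| <= m^-1 * (phi t - phi s).
  move=> t0s st tb; rewrite ler_pdivlMl//.
  apply: (curve_chart_le Cv Mc m0 mc) => //; first lra.
  move=> u /andP[su ut]; have [||] // := domV u; first exact: lt_le_trans su.
  exact: le_trans ut tb.
have phi0 t : t0 <= t -> t <= b -> 0 <= phi t - phi t0.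
  move=> t0t tb.
  rewrite /phi Rintegral_itvB//.
    by apply: Rintegral_ge0 => r _; exact: fnorm_ge0.
  by apply: integrableS gint => //; apply: subset_itvl; rewrite bnd_simp.
have phiub : \forall t \near t0^'+, phi t - phi t0 <= (g t0 + 1) * (t - t0).
  near=> t.
  have t0t : t0 < t by near: t; exact: nbhs_right_gt.
  have [tb gt] : t <= b /\ forall u, t0 <= u <= t -> `|g t0 - g u| <= 1.
    by near: t; apply: near_right_le gc at0 t0b ltr01.
  have /andP[_] : (g t0 - 1) * (t - t0) <= phi t - phi t0 <= (g t0 + 1) * (t - t0).
    apply: (Rintegral_itv_bounds gint); [by []|exact: ltW|by []|].
    move=> w /andP[uw wr]; have := gt w; rewrite (ltW uw) wr => /(_ isT).
    by rewrite ler_distl => /andP[? ?]; apply/andP; split; lra.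
  by [].
have g0 : 0 <= g t0 by exact: fnorm_ge0.
have : cvg (beta t @[t --> t0^'+]).
  apply: cauchy_cvg; apply/cauchyP => e e0.
  (* Chosen so that (g t0 + 1) * (t - t0) < m * e whenever t0 < t < t0 + e1; with [bl] this gives
     the Cauchy property. *)
  pose e1 := e * m / (g t0 + 2).
  have g2 : 0 < g t0 + 2 by lra.
  have e10 : 0 < e1 by rewrite divr_gt0 ?mulr_gt0.
  have [t [t0t tb tt tphi]] : exists t, [/\ t0 < t, t <= b,
      t < t0 + e1 & phi t - phi t0 <= (g t0 + 1) * (t - t0)].
    apply: (@filter_ex _ t0^'+); near=> t; split; near: t => //.
    - exact: nbhs_right_gt.
    - exact: nbhs_right_ltW.
    - by apply: nbhs_right_lt; rewrite ltrDl.
  exists (beta t).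
  suff : \forall s \near t0^'+, ball (beta t) e (beta s) by [].
  near=> s.
  have t0s : t0 < s by near: s; exact: nbhs_right_gt.
  have st : s <= t by near: s; exact: nbhs_right_ltW.
  rewrite /= -ball_normE /ball_ /=.
  apply: le_lt_trans (bl s t t0s st tb) _.
  rewrite ltr_pdivrMl//.
  have := phi0 s (ltW t0s) (le_trans st tb).
  have : (g t0 + 1) * (t - t0) < m * e.
    apply: (@le_lt_trans _ _ ((g t0 + 2) * (t - t0))).
      by apply: ler_wpM2r; lra.
    by rewrite -ltr_pdivlMl// mulrC (mulrC m) -/e1; lra.
  lra.
move=> /cvg_ex[z bz].
(* A strict bound survives the limit because the whole length is less than m * d. *)
have bz' : `|cmap c (alpha b) - z| < d.
  apply: (@le_lt_trans _ _ (m^-1 * phi b)); last by rewrite ltr_pdivrMl.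
  have nb : `|beta b - beta t| @[t --> t0^'+] --> `|beta b - z|.
    by apply: cvg_norm; apply: cvgB bz; exact: cvg_cst.
  apply: (cvgr_to_le nb).
  near=> t.
  have t0t : t0 < t by near: t; exact: nbhs_right_gt.
  have tb : t <= b by near: t; exact: nbhs_right_ltW.
  apply: (le_trans (bl t b t0t tb (lexx b))).
  rewrite ler_pM2l ?invr_gt0// lerBlDr lerDl.
  by apply: Rintegral_ge0 => u _; exact: fnorm_ge0.
have cz := ballc z bz'.
have az : alpha t @[t --> t0^'+] --> cinv c z.
  have bz2 : cinv c (beta t) @[t --> t0^'+] --> cinv c z.
    exact: cvg_comp bz (cinv_continuous_at cz).
  apply: cvg_trans bz2; apply: near_eq_cvg; near=> t.
  have t0t : t0 < t by near: t; exact: nbhs_right_gt.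
  have tb : t <= b by near: t; exact: nbhs_right_ltW.
  by have [ca _] := domV t t0t tb; rewrite /beta cmapK.
have at0' : alpha t @[t --> t0^'+] --> alpha t0.
  apply: cvg_trans (ac t0 t0ab); apply: cvg_app => P PP.
  have t0P : \forall t \near t0, t \in `[a, b] -> P t by exact: PP.
  suff : \forall t \near t0, t0 < t -> P t by [].
  have : \forall t \near t0, t < b by exact: lt_nbhsl.
  apply: filterS2 t0P => t tP tb t0t; apply: tP.
  by rewrite in_itv /=; apply/andP; split; lra.
apply: nVt0.
have -> : alpha t0 = cinv c z.
  by apply: (cvg_unique (manifold_hausdorff M) at0' az).
have [cq cqE] := cinv_cran cz.
by split => //; rewrite cqE.
Unshelve. all: by end_near. Qed.

(** A curve ending at x of length below m * d starts in the chart ball of radius d about x, by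
    [short_curve_in_ball]. The point x is the second argument of [fdist], as the limit is in
    [fcomplete]. *)
Lemma fdist_near x (U : set X) : nbhs x U -> exists2 d : R, 0 < d &
  forall y, (fdist N y x < d%:E)%E -> U y.
Proof.
move=> Ux; have [c [m [k [cx m0 k0 mk]]]] := chart_norm_equiv N x.
have [Mc xc] := cx.
have cran_x : cran c (cmap c x) by exists x.
have /nbhs_ballP[d /= d0 dU] : \forall z \near cmap c x, cran c z /\ U (cinv c z).
  apply: filterI; first exact: nbhs_cran.
  by have := cinv_continuous_at cran_x; apply; rewrite cmapK.
exists (m * d); first by rewrite mulr_gt0.
move=> y /ereal_inf_lt[_ [a [b [alpha [v [ab Cv <- ax ->]]]]] short].
rewrite -ax in cx dU xc cran_x Ux *.
have gint : mu.-integrable `[a, b] (EFin \o (fun u => fnorm N (v u))).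
  apply: continuous_compact_integrable; first exact: segment_compact.
  exact: (speed_continuous (N := N) Cv).
have [|||ca da] := @short_curve_in_ball a b alpha v c m d ab Cv cx m0.
- by move=> y' cy' w; have /andP[] := mk y' cy' w.
- by move=> z zd; have [] := dU z; rewrite -?ball_normE.
- rewrite -lte_fin; apply: le_lt_trans short.
  by rewrite /Rintegral fineK//; exact: integrable_fin_num.
- by have := dU (cmap c (alpha a)); rewrite -ball_normE /= cmapK// => /(_ da)[].
Qed.

End fdist_topology.

(** * The descent step *)

Section identity_chart.
Context {R : realType} (F : normedModType R).

Lemma opnorm_le (V W : lmodType R) (p : V -> \bar R) (q : W -> \bar R)
    (T : V -> W) (k : \bar R) :
  (forall v, (p v <= 1)%E -> (q (T v) <= k)%E) -> (opnorm p q T <= k)%E.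
Proof. by move=> Tk; apply: ge_ereal_sup => _ [v pv <-]; exact: Tk. Qed.

Lemma C2_on_id (U : set F) : C2_on U (id : F -> F).
Proof.
have did x y : ('d id y \- 'd id x)%R = (fun=> 0) :> (F -> F).
  by apply/funext => v; rewrite /= !diff_val subrr.
split.
  move=> x _; split => // e e0; apply: nearW => y.
  by apply: opnorm_le => v _; rewrite did /enorm normr0 lee_fin ltW.
exists (fun _ _ _ => 0) => x _; split.
- split; first by move=> a u v; apply/funext => w; rewrite fctE /= scaler0 addr0.
  by move=> h a u v; rewrite scaler0 addr0.
- apply: (@le_lt_trans _ _ 0%:E); last exact: ltry.
  by apply: opnorm_le => v _; apply: opnorm_le => w _; rewrite /enorm normr0.
- move=> e e0; apply: nearW => y; apply: opnorm_le => v _.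
  by rewrite /enorm /= !diff_val subrr subr0 normr0 lee_fin mulr_ge0// ltW.
- move=> e e0; apply: nearW => y; apply: opnorm_le => v _.
  by apply: opnorm_le => w _; rewrite /enorm /= subrr normr0 lee_fin ltW.
Qed.

Fact id_chart_open : open (id @` [set: F]).
Proof. by rewrite image_id; exact: openT. Qed.

Fact id_chart_continuous (A : set F) : {within A, continuous id}.
Proof. by apply: continuous_subspaceT => x; exact: cvg_id. Qed.

Definition id_chart : chart F F :=
  @Chart R F F setT id id openT id_chart_open (fun _ _ => erefl)
    (@id_chart_continuous _) (@id_chart_continuous _).

Lemma vchart_id : vchart id_chart.
Proof. by split; exact: C2_on_id. Qed.

End identity_chart.

Section descent.
Context {R : realType} {X : topologicalType} {E F : completeNormedModType R}.
Context {M : C2manifold X E}.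
Variable N : finsler M.
Implicit Types (c : chart X E) (x : X) (f : X -> F).

(** The identity chart of F is admissible as target chart, and with it the local representative is f
    read in [c] alone. *)
Lemma C1_map_differentiable f c x : C1_map M f -> chart_at M x c ->
  differentiable (f \o cinv c) (cmap c x).
Proof.
move=> [_ /(_ c (id_chart F))C1f] [Mc cx].
have [] := C1f _ (cmap c x) _ => //; last by exists x.
by split => //; exact: vchart_id.
Qed.

Lemma tnorm_le_opnorm x (s : {linear F -> tangent M x}) (k : R) u :
  opnorm enorm (tnorm N) s = k%:E -> fnorm N (s u) <= k * `|u|.
Proof.
move=> sk; have [->|u0] := eqVneq u 0.
  by rewrite linear0 fnorm0 normr0 mulr0.
have nu : 0 < `|u| by rewrite normr_gt0.
have : (tnorm N (s (`|u|^-1 *: u)) <= k%:E)%E.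
  rewrite -sk; apply: ereal_sup_ubound; exists (`|u|^-1 *: u) => //.
  by rewrite /= /enorm lee_fin normrZ normfV normr_id mulVf// lt0r_neq0.
by rewrite /tnorm lee_fin linearZ fnormZ normfV normr_id ler_pdivrMl// mulrC.
Qed.

Lemma fnorm_tvecZ c x (a : R) (w : E) :
  fnorm N (tvec M c x (a *: w)) = `|a| * fnorm N (tvec M c x w).
Proof. by rewrite linearZ fnormZ. Qed.

(** This is continuity of the norm on the tangent bundle, along vectors whose coordinates w are
    constant. *)
Lemma near_tvec_norm_lt c (z w : E) (k : R) : atlas M c -> cran c z ->
  fnorm N (tvec M c (cinv c z) w) < k ->
  \forall z' \near z, cran c z' /\ fnorm N (tvec M c (cinv c z') w) < k.
Proof.
move=> Mc cz zk; apply: filterI; first exact: nbhs_cran.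
pose h z' : E * E := (z', w).
have hc : h z' @[z' --> z] --> (z, w).
  by apply: cvg_pair; [exact: cvg_id | exact: cvg_cst].
have tc : tb_chart M c (h z') @[z' --> z] --> tb_chart M c (z, w).
  by apply: cvg_comp hc _; exact: tb_chart_continuous_at.
have nc : fnorm N (tb_vec (tb_chart M c (h z'))) @[z' --> z] -->
    fnorm N (tb_vec (tb_chart M c (z, w))).
  exact: cvg_comp tc (@fnorm_continuous _ _ _ _ N (tb_chart M c (z, w))).
exact: cvgr_lt nc _ zk.
Qed.

(** In a chart, move from x by t *: w, where w represents s (y - f x). To first order f moves by t
    *: (y - f x), so |y - f| drops by about t * |y - f x|, at a length of about t * sigma * |y - f
    x|. *)
Lemma descent_step f x y (s : {linear F -> tangent M x}) (sigma eps : R) :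
  C1_map M f -> (forall u, tdiff f (s u) = u) ->
  (forall u, fnorm N (s u) <= sigma * `|u|) -> 0 < sigma ->
  f x != y -> 0 < eps -> eps < 1 ->
  exists x' d, [/\ 0 < d, joined N x x' d &
    `|y - f x'| <= `|y - f x| - (1 - eps) * (d / sigma)].
Proof.
move=> C1f fs sle sigma0 fxy eps0 eps1.
have [c cx] := atlas_cover M x; have [Mc xc] := cx.
set u := y - f x; have u0 : 0 < `|u| by rewrite normr_gt0 subr_eq0 eq_sym.
set z := cmap c x; set w := (s u : chart X E -> E) c; set g := f \o cinv c.
have gz : g z = f x by rewrite /g /z /= cmapK.
have cz : cran c z by exists x.
have dg : differentiable g z by exact: C1_map_differentiable.
have dgw : 'd g z w = u by rewrite -[RHS](fs u) (tdiffE _ cx dg).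
(* Two relative errors e occur, one in the length and one in the decrease; eps = 2 * e absorbs both
   since (1 - 2 * e) * (1 + e) <= 1 - e. *)
have [e e0 epsE] : exists2 e, 0 < e & eps = 2 * e.
  by exists (eps / 2); [rewrite divr_gt0 | field].
(* The factor 1 + e makes the bound on the norm of w strict, so that it persists at nearby base
   points. *)
pose k := (1 + e) * (sigma * `|u|).
have wk : fnorm N (tvec M c (cinv c z) w) < k.
  rewrite /z cmapK// tvec_tcoord//; apply: le_lt_trans (sle u) _.
  by rewrite /k ltr_pMl ?mulr_gt0// ltrDl.
have /nbhs_ballP[d /= d0 dk] := near_tvec_norm_lt Mc cz wk.
have w1 : 0 < `|w| + 1 by rewrite ltr_pwDr.
have e1 : 0 < e * `|u| / (`|w| + 1) by rewrite divr_gt0// mulr_gt0.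
have /diff_locallyP[_ /eqaddoP/(_ _ e1)] := dg.
move=> /nbhs_ballP[r /= r0 dgr].
(* This t keeps the segment in the ball where the norm bound holds, keeps t *: w where the expansion
   of g is valid, and leaves 1 - t nonnegative. The 1 in |w| + 1 allows w = 0. *)
pose t := Num.min 1 (Num.min (d / 2) (r / 2) / (`|w| + 1)).
have m0 : 0 < Num.min (d / 2) (r / 2) by rewrite lt_min !divr_gt0.
have t0 : 0 < t by rewrite lt_min ltr01 divr_gt0.
have t1 : t <= 1 by rewrite ge_min lexx.
have tw : t * (`|w| + 1) <= Num.min (d / 2) (r / 2).
  by rewrite -ler_pdivlMr// ge_min lexx orbT.
have twd : t * `|w| < d.
  have : t * (`|w| + 1) <= d / 2 by apply: (le_trans tw); rewrite ge_min lexx.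
  by rewrite mulrDr mulr1; lra.
have twr : t * `|w| < r.
  have : t * (`|w| + 1) <= r / 2.
    by apply: (le_trans tw); rewrite ge_min lexx orbT.
  by rewrite mulrDr mulr1; lra.
have k0 : 0 < k by rewrite !mulr_gt0// addr_gt0.
exists (cinv c (z + t *: w)), (t * k); split; first by rewrite mulr_gt0.
- rewrite -[x in joined N x](cmapK xc).
  apply: joined_segment => // tau /andP[tau0 tau1].
  have [|cq qk] := dk (z + tau *: (t *: w)).
    rewrite -ball_normE /ball_ /= opprD addrA subrr add0r normrN !normrZ.
    rewrite (ger0_norm tau0) (gtr0_norm t0); apply: le_lt_trans twd.
    by rewrite ler_piMl// mulr_ge0// ltW.
  split => //; rewrite fnorm_tvecZ gtr0_norm// ler_pM2l//; exact: ltW.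
- have gt : `|g (z + t *: w) - g z - t *: u| <= e * `|u| * t.
    have /dgr : ball 0 r (t *: w).
      by rewrite -ball_normE /ball_ /= sub0r normrN normrZ gtr0_norm.
    rewrite !fctE /= linearZ /= dgw [t *: w + z]addrC opprD addrA.
    move=> /le_trans; apply; rewrite normrZ (gtr0_norm t0).
    rewrite -!mulrA; apply: ler_wpM2l; first exact: ltW.
    apply: ler_wpM2l; first exact: normr_ge0.
    by rewrite ler_pdivrMl// mulrDl mul1r mulrC lerDl ltW.
  have : `|y - f (cinv c (z + t *: w))| <= (1 - t) * `|u| + e * `|u| * t.
    have -> : y - f (cinv c (z + t *: w)) =
        (1 - t) *: u - (g (z + t *: w) - g z - t *: u).
      by rewrite gz scalerBl scale1r opprB addrA subrK opprB addrA /u subrK.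
    apply: (le_trans (ler_normB _ _)); apply: lerD => //.
    by rewrite normrZ ger0_norm//; lra.
  move=> /le_trans; apply.
  have -> : t * k / sigma = t * (1 + e) * `|u|.
    by rewrite /k; field; rewrite lt0r_neq0.
  rewrite epsE -subr_ge0.
  rewrite (_ : _ - _ = t * `|u| * (2 * (e * e))); last by ring.
  by rewrite !mulr_ge0// ltW.
Qed.

End descent.

(** * The variational principle *)

Section variational_principle.
Context {R : realType} {X : topologicalType} {E : completeNormedModType R}.
Context {M : C2manifold X E}.
Variable N : finsler M.
Implicit Types (x : X).

(** Completeness yields a limit for [fdist], and [fdist_near] makes it a limit in the topology.
    Indices m <= n suffice because [joined] is symmetric. *)
Lemma joined_cauchy_cvg (x_ : nat -> X) : fcomplete N ->
  (forall e : R, 0 < e -> exists n0, forall m n, (n0 <= m)%N -> (m <= n)%N ->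
     exists2 d, d < e & joined N (x_ m) (x_ n) d) ->
  exists l : X, forall U : set X, nbhs l U ->
    exists n0, forall n, (n0 <= n)%N -> U (x_ n).
Proof.
move=> Ncomplete xC; have [|l xl] := Ncomplete x_.
  move=> e /xC[n0 n0C]; exists n0 => m n n0m n0n.
  have [mn|/ltnW nm] := leqP m n.
    have [d de /joined_fdist] := n0C _ _ n0m mn.
    by move=> /le_lt_trans; apply; rewrite lte_fin.
  have [d de /joined_sym/joined_fdist] := n0C _ _ n0n nm.
  by move=> /le_lt_trans; apply; rewrite lte_fin.
exists l => U /(fdist_near N)[d d0 dU].
by have [n0 n0d] := xl d d0; exists n0 => n /n0d/dU.
Qed.

(* The length l is the Lyapunov function: along the order generated by the
   descent steps it increases and stays below r. *)
Lemma descent_principle (phi : X -> R) (G : R -> R) (k r : R) x0 :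
  fcomplete N -> continuous phi ->
  (forall x, 0 <= phi x) ->
  (forall l l', 0 <= l -> l <= l' -> 0 <= G l' - G l <= k * (l' - l)) ->
  0 < r -> phi x0 < G r - G 0 ->
  (forall x l, 0 <= l -> (fdist N x0 x <= l%:E)%E -> 0 < phi x ->
    exists x' d, [/\ 0 < d, joined N x x' d &
      phi x' <= phi x - (G (l + d) - G l)]) ->
  exists2 x, phi x = 0 & (fdist N x0 x < r%:E)%E.
Proof.
move=> Ncomplete phic phi0 Gk r0 phir step.
(* A state is a point with the length spent to reach it. The slack e lets the relation pass to limit
   points, which are reached by one more arbitrarily short arc. *)
pose ord (p q : X * R) := [/\ p.2 <= q.2,
  forall e, 0 < e -> joined N p.1 q.1 (q.2 - p.2 + e) &
  phi q.1 <= phi p.1 - (G q.2 - G p.2)].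
have ord_refl p : ord p p.
  split; rewrite ?subrr ?subr0// => e e0; rewrite add0r.
  by apply: joined_le (joined_refl N p.1); exact: ltW.
have ord_trans q p s : ord p q -> ord q s -> ord p s.
  move=> [pq Dpq fpq] [qs Dqs fqs]; split; [exact: le_trans qs| |lra].
  move=> e e0; have e20 : 0 < e / 2 by rewrite divr_gt0.
  have := joined_trans (Dpq _ e20) (Dqs _ e20); apply: joined_le; lra.
pose p0 : X * R := (x0, 0).
(* Spending length r would force phi below phi x0 - (G r - G 0) < 0. *)
have lt_r p : ord p0 p -> p.2 < r.
  move=> [/= p20 _ fp]; rewrite ltNge; apply/negP => rp.
  by have := phi0 p.1; have /andP[] := Gk r p.2 (ltW r0) rp; lra.
have dist_p p : ord p0 p -> (fdist N x0 p.1 <= p.2%:E)%E.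
  move=> [_ Dp _]; apply/lee_addgt0Pr => e /Dp /=.
  by rewrite subr0 => /joined_fdist.
apply: contrapT => nex.
have phi_gt0 p : ord p0 p -> 0 < phi p.1.
  move=> p0p; rewrite lt_neqAle phi0 andbT eq_sym; apply/eqP => phip.
  apply: nex; exists p.1 => //; apply: (le_lt_trans (dist_p p p0p)).
  by rewrite lte_fin; exact: lt_r.
pose len p := [set l | exists2 q, ord p q & l = q.2].
have len_sup p : ord p0 p -> has_sup (len p).
  move=> p0p; split; first by exists p.2, p.
  by exists r => _ [q pq ->]; rewrite ltW// lt_r//; exact: (ord_trans _ _ _ p0p pq).
(* From the n-th state, choose a successor whose length is within 1 / (n + 1) of the supremum over
   all successors. *)
have [next nextP] : exists next : nat * (X * R) -> X * R, forall np,
    ord p0 np.2 -> ord np.2 (next np) /\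
      forall q, ord np.2 q -> q.2 < (next np).2 + np.1.+1%:R^-1.
  suff nextE (np : nat * (X * R)) : exists q', ord p0 np.2 -> ord np.2 q' /\
      forall q, ord np.2 q -> q.2 < q'.2 + np.1.+1%:R^-1.
    by have [next nextP] := choice nextE; exists next.
  case: np => n p /=.
  have [p0p|] := pselect (ord p0 p); last by exists p.
  have n1 : 0 < n.+1%:R^-1 :> R by rewrite invr_gt0.
  have [_ [q pq ->] supq] := sup_adherent n1 (len_sup p p0p).
  exists q => _; split => // q' pq'.
  have : q'.2 <= sup (len p).
    by apply: ub_le_sup; [exact: (len_sup p p0p).2 | exists q'].
  by rewrite -ltrBlDr => q'le; apply: le_lt_trans supq; rewrite lerD2r.
pose u := fix u n := if n is n'.+1 then next (n', u n') else p0.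
have u0 n : ord p0 (u n).
  elim: n => [|n IH]; first exact: ord_refl.
  by have [/= un _] := nextP (n, u n) IH; exact: (ord_trans _ _ _ IH un).
have u_le m n : (m <= n)%N -> ord (u m) (u n).
  elim: n => [|n IH]; first by rewrite leqn0 => /eqP ->.
  rewrite leq_eqVlt => /predU1P[->//|]; rewrite ltnS => /IH mn.
  by have [/= un _] := nextP (n, u n) (u0 n); exact: (ord_trans _ _ _ mn un).
pose A := [set (u n).2 | n in [set: nat]].
have supA : has_sup A.
  by split; [exists 0, 0 | exists r => _ [n _ <-]; rewrite ltW// lt_r].
set ls := sup A.
have u_ls n : (u n).2 <= ls by apply: ub_le_sup; [exact: supA.2|exists n].
have ls_u e : 0 < e -> exists n0, forall n, (n0 <= n)%N -> ls - e < (u n).2.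
  move=> e0; have [_ [n0 _ <-] n0e] := sup_adherent e0 supA.
  by exists n0 => n /u_le[n0n _ _]; exact: lt_le_trans n0n.
have [xs u_xs] : exists xs : X, forall U : set X, nbhs xs U ->
    exists n0, forall n, (n0 <= n)%N -> U (u n).1.
  apply: joined_cauchy_cvg => // e e0; have e20 : 0 < e / 2 by rewrite divr_gt0.
  have [n0 n0e] := ls_u _ e20; exists n0 => m n n0m mn.
  have [_ /(_ _ e20) Dmn _] := u_le _ _ mn.
  exists ((u n).2 - (u m).2 + e / 2) => //.
  by have := n0e _ n0m; have := u_ls n; lra.
(* The limit state dominates every u n: [joined_near] bridges the last gap between points, while
   continuity of phi and the bound k on the slopes of G handle the decrease. *)
have u_lim n : ord (u n) (xs, ls).
  have late (U : set X) e : nbhs xs U -> 0 < e ->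
      exists m, [/\ (n <= m)%N, U (u m).1 & ls - e < (u m).2].
    move=> /u_xs[n1 n1U] /ls_u[n2 n2e]; exists (maxn n (maxn n1 n2)).
    rewrite leq_maxl; split => //.
      by apply: n1U; rewrite leq_max leq_maxl orbT.
    by apply: n2e; rewrite leq_max leq_maxr orbT.
  split => //=.
  - move=> e e0; have e20 : 0 < e / 2 by rewrite divr_gt0.
    have [m [nm mj _]] := late _ 1 (joined_near N xs e20) ltr01.
    have [_ /(_ _ e20) Dnm _] := u_le _ _ nm.
    have := joined_trans Dnm mj; apply: joined_le.
    by have := u_ls m; lra.
  - apply/ler_addgt0Pr => e e0.
    have e20 : 0 < e / 2 by rewrite divr_gt0.
    have k1 : 0 < `|k| + 1 by rewrite ltr_pwDr.
    have d0 : 0 < e / 2 / (`|k| + 1) by rewrite divr_gt0.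
    have phin : nbhs xs [set x | `|phi xs - phi x| < e / 2].
      by have /cvgrPdist_lt/(_ _ e20) := phic xs.
    have [m [nm + mls]] := late _ _ phin d0.
    rewrite /= ltr_distl => /andP[_ phim].
    have [_ _ fnm] := u_le _ _ nm.
    have [um0 _ _] := u0 m.
    have /andP[_ Gm] := Gk _ _ um0 (u_ls m).
    have : k * (ls - (u m).2) <= e / 2.
      have lm : 0 <= ls - (u m).2 by rewrite subr_ge0.
      have kk : k <= `|k| + 1 by rewrite ler_wpDr// ler_norm.
      apply: (@le_trans _ _ ((`|k| + 1) * (ls - (u m).2))).
        exact: ler_wpM2r.
      rewrite -ler_pdivlMl//; move: mls; rewrite [_^-1 * _]mulrC; lra.
    by lra.
have p0s := u_lim 0%N.
have [ls0 _ _] := p0s.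
have [x' [d [d0 jd phid]]] := step xs ls ls0 (dist_p _ p0s) (phi_gt0 _ p0s).
have s_next : ord (xs, ls) (x', ls + d).
  split => //=; first by rewrite lerDl ltW.
  by move=> e e0; apply: joined_le jd; lra.
(* The state obtained from the limit by a further move also succeeds u n, so ls + d < (u n.+1).2 + 1
   / (n + 1) <= ls + 1 / (n + 1), which fails once 1 / (n + 1) < d. *)
have [n nd] : exists n : nat, n.+1%:R^-1 < d.
  exists (Num.truncn d^-1).
  by rewrite invf_plt ?posrE// truncnS_gt.
have [_ /(_ (x', ls + d))] := nextP (n, u n) (u0 n).
move=> /(_ (ord_trans _ _ _ (u_lim n) s_next)) /=.
have /= := u_ls n.+1; move: nd; set e := n.+1%:R^-1; clearbody e.
by move=> *; lra.
Qed.

End variational_principle.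

(** * Real-valued form of [eta] and its integral *)

Lemma nonincreasing_Rintegral_bounds (R : realType) (h : R -> R) (l l' : R) :
  {homo h : s t /~ t <= s} -> (forall t, 0 <= h t) -> 0 <= l -> l <= l' ->
  lebesgue_measure.-integrable `[0, l'] (EFin \o h) /\
  0 <= \int[lebesgue_measure]_(t in `[0, l']) h t -
    \int[lebesgue_measure]_(t in `[0, l]) h t <= h l * (l' - l).
Proof.
move=> hdec h0 l0 ll'.
have hint : lebesgue_measure.-integrable `[0, l'] (EFin \o h).
  apply: measurable_bounded_integrable => //.
  - rewrite [X in (X < _)%E]lebesgue_measure_itv /=.
    by case: ifP => _; rewrite ?ltry// -EFinB ltry.
  - by apply: nonincreasing_measurable.
  - exists (h 0); split; first by rewrite num_real.
    move=> k hk t /=; rewrite in_itv /= => /andP[t0 _].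
    by rewrite ger0_norm// (le_trans _ (ltW hk))// hdec.
split => //; rewrite -[X in X <= _](mul0r (l' - l)).
(* By monotonicity h lies between 0 and its left end value h l on ]l, l']. *)
apply: (Rintegral_itv_bounds hint) => // t /andP[lt _].
by rewrite h0 hdec// ltW.
Qed.

Section surjectivity_indicator.
Context {R : realType} {X : topologicalType} {E F : completeNormedModType R}.
Context {M : C2manifold X E}.
Variable N : finsler M.
Implicit Types (x : X) (f : X -> F).

Lemma opnorm_tnorm_ge0 x (s : {linear F -> tangent M x}) :
  (0 <= opnorm enorm (tnorm N) s)%E.
Proof.
apply: ereal_sup_ubound; exists 0; first by rewrite /= /enorm normr0 lee_fin.
by rewrite linear0 /tnorm fnorm0.
Qed.

Lemma Sur_ge0 f x : (0 <= Sur N f x)%E.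
Proof.
apply: le_ereal_inf_tmp => _ [phi _ <-]; apply: ereal_sup_ubound.
exists 0; first by rewrite /= /tnorm fnorm0 lee_fin.
rewrite /= /tdiff /=; case: cid => c cx /=.
by rewrite (linear0 ('d (f \o cinv c) (cmap c x))) linear0 /enorm normr0.
Qed.

(** If the norm were 0, s u would vanish, and so would u = df(x)(s u). The vector u != 0 excludes
    the case F = 0. *)
Lemma right_inverse_norm f x (s : {linear F -> tangent M x}) u :
  (opnorm enorm (tnorm N) s < +oo)%E -> tdiff f (s u) = u -> u != 0 ->
  exists2 k : R, 0 < k & opnorm enorm (tnorm N) s = k%:E.
Proof.
move=> sfin fsu u0; have s0 := opnorm_tnorm_ge0 s.
have sk : opnorm enorm (tnorm N) s = (fine (opnorm enorm (tnorm N) s))%:E.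
  by rewrite fineK// ge0_fin_numE.
exists (fine (opnorm enorm (tnorm N) s)) => //.
rewrite lt_neqAle fine_ge0// andbT eq_sym; apply/eqP => k0.
have := tnorm_le_opnorm u sk; rewrite k0 mul0r => su.
have {}su : s u = 0.
  by apply: (@fnorm_eq0 _ _ _ _ N); apply: le_anti; rewrite su fnorm_ge0.
move/eqP: u0; apply; rewrite -fsu su /tdiff /=; case: cid => c cx /=.
by rewrite (linear0 ('d (f \o cinv c) (cmap c x))).
Qed.

(** For rho >= 0 the ball contains x0, whose indicator makes the infimum finite; each other point x
    of the ball bounds it in the same way. Here [sigma x] stands for the norm of s(x). *)
Lemma eta_finite f (c : R) x0 (sigma : X -> R) : 0 < c ->
  (forall x, 0 < sigma x) ->
  (forall x, (Sur N f x <= (c / sigma x)%:E)%E) ->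
  exists h : R -> R, [/\
    forall rho, 0 <= rho -> Defs.eta N f c x0 rho = (h rho)%:E,
    forall rho, 0 <= h rho,
    {homo h : s t /~ t <= s}
  & forall x rho, 0 <= rho -> (fdist N x0 x <= rho%:E)%E ->
      h rho <= (sigma x)^-1].
Proof.
move=> c0 sigma0 Surc.
have cV0 : (0 <= (c^-1)%:E)%E by rewrite lee_fin invr_ge0 ltW.
have eta_le x rho : (fdist N x0 x <= rho%:E)%E ->
    (Defs.eta N f c x0 rho <= ((sigma x)^-1)%:E)%E.
  move=> xrho; rewrite -[(sigma x)^-1](mulKf (lt0r_neq0 c0)) EFinM.
  apply: lee_wpmul2l => //; apply: le_trans (Surc x).
  by apply: ereal_inf_lbound; exists x.
have eta_ge0 rho : (0 <= Defs.eta N f c x0 rho)%E.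
  by apply: mule_ge0 => //; apply: le_ereal_inf_tmp => _ [x _ <-]; exact: Sur_ge0.
have d00 rho : 0 <= rho -> (fdist N x0 x0 <= rho%:E)%E.
  by move=> rho0; apply: joined_fdist; apply: joined_le rho0 (joined_refl N x0).
(* For rho < 0 the infimum runs over an empty set and is +oo, which [fine] would send to 0;
   truncating at 0 keeps h nonincreasing on the whole line. *)
pose h rho := fine (Defs.eta N f c x0 (Num.max 0 rho)).
have m0 (rho : R) : 0 <= Num.max 0 rho by rewrite le_max lexx.
have hE rho : Defs.eta N f c x0 (Num.max 0 rho) = (h rho)%:E.
  rewrite fineK// ge0_fin_numE//.
  by apply: le_lt_trans (eta_le x0 _ (d00 _ (m0 _))) _; exact: ltry.
exists h; split.
- by move=> rho rho0; rewrite -hE max_r.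
- by move=> rho; exact: fine_ge0.
- move=> s t st; rewrite -lee_fin -!hE; apply: lee_wpmul2l => //.
  apply: ereal_inf_le_tmp; apply: image_subset => x /= /le_trans; apply.
  by rewrite lee_fin ge_max le_max lexx /= le_max st orbT.
- move=> x rho rho0 xrho; rewrite -lee_fin -hE; apply: eta_le.
  by rewrite max_r.
Qed.

End surjectivity_indicator.

(** * The inclusion of balls *)

Unset Implicit Arguments.
Set Strict Implicit.

Theorem theorem18 (R : realType) (X : topologicalType)
    (E F : completeNormedModType R) (M : C2manifold X E) (N : finsler M)
    (X_connected : connected [set: X]) (X_complete : fcomplete N)
    (f : X -> F)
    (f_submersion : submersion M f)
    (f_split : unif_split_kernels N f)
    (f_lip : loc_lipschitz_derivative M f)
    (c : R) (c_gt0 : 0 < c)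
    (c_right_inverse : exists s : forall x, {linear F -> tangent M x},
       loc_lipschitz_right_inverse N f s /\
       forall x, (Sur N f x <= c%:E * (opnorm enorm (tnorm N) (s x))^-1)%E)
    (x0 : X) (r : R) (r_gt0 : 0 < r) :
  (0 < varrho N f c x0 r)%E ->
  [set y | (`|y - f x0|%:E < varrho N f c x0 r)%E]
    `<=` f @` [set x | (fdist N x0 x < r%:E)%E].
Proof.
move=> _ y /= yrho; have [C1f _] := f_submersion.
(* Apart from the trivial case y = f x0, the vector y - f x0 shows F to be nonzero, so that every
   s(x) has positive norm. *)
have [->|yx0] := eqVneq y (f x0).
  exists x0 => //=; apply: le_lt_trans (joined_fdist (joined_refl N x0)) _.
  by rewrite lte_fin.
have u0 : y - f x0 != 0 by rewrite subr_eq0.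
have [s [[sfin fs _] Surs]] := c_right_inverse.
have [sigma sigmaP] : exists sigma : X -> R, forall x, 0 < sigma x /\
    opnorm enorm (tnorm N) (s x) = (sigma x)%:E.
  suff sE x : exists k : R, 0 < k /\ opnorm enorm (tnorm N) (s x) = k%:E.
    by have [sigma ?] := choice sE; exists sigma.
  by have [k k0 sk] := right_inverse_norm (sfin x) (fs x _) u0; exists k.
have sigma0 x : 0 < sigma x by have [] := sigmaP x.
have sigmaE x : opnorm enorm (tnorm N) (s x) = (sigma x)%:E by have [] := sigmaP x.
have Surc x : (Sur N f x <= (c / sigma x)%:E)%E.
  by have := Surs x; rewrite sigmaE inver gt_eqF// -EFinM.
have [h [hE h0 hdec hle]] := eta_finite x0 c_gt0 sigma0 Surc.
pose Phi l := \int[lebesgue_measure]_(t in `[0, l]) h t.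
have PhiE : varrho N f c x0 r = (Phi r)%:E.
  have [hint _] := nonincreasing_Rintegral_bounds hdec h0 (lexx 0) (ltW r_gt0).
  rewrite /Phi /Rintegral fineK; last exact: integrable_fin_num.
  apply: eq_integral => t; rewrite inE /= in_itv /= => /andP[t0 _].
  by rewrite hE.
move: yrho; rewrite PhiE lte_fin => yrho.
have A0 : 0 < `|y - f x0| by rewrite normr_gt0.
have Phi0 : 0 < Phi r by exact: lt_trans yrho.
(* With this eps, (1 - eps) * Phi r is the midpoint of |y - f x0| and Phi r. *)
pose eps := (Phi r - `|y - f x0|) / (2 * Phi r).
have eps0 : 0 < eps by rewrite divr_gt0 ?subr_gt0 ?mulr_gt0.
have eps1 : eps < 1 by rewrite ltr_pdivrMr ?mulr_gt0//; lra.
have yeps : `|y - f x0| < (1 - eps) * Phi r.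
  have -> : (1 - eps) * Phi r = (Phi r + `|y - f x0|) / 2.
    by rewrite /eps; field; rewrite lt0r_neq0.
  lra.
clearbody eps.
have [x fx xr] : exists2 x, `|y - f x| = 0 & (fdist N x0 x < r%:E)%E.
  (* The slopes of (1 - eps) * Phi are at most h 0, since h is nonincreasing. *)
  apply: (@descent_principle _ _ _ _ N (fun x => `|y - f x|)
    (fun l => (1 - eps) * Phi l) (h 0) r x0) => //.
  - move=> x; have [fc _] := C1f.
    by apply: cvg_norm; apply: cvgB; [exact: cvg_cst | exact: fc].
  - move=> l l' l0 ll'; rewrite -mulrBr.
    have [_ /andP[P0 Pl]] := nonincreasing_Rintegral_bounds hdec h0 l0 ll'.
    have e10 : 0 <= 1 - eps by lra.
    rewrite mulr_ge0//=; apply: (@le_trans _ _ (1 * (Phi l' - Phi l))).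
      by apply: ler_wpM2r => //; lra.
    rewrite mul1r; apply: (le_trans Pl); apply: ler_wpM2r; first by rewrite subr_ge0.
    exact: hdec.
  - by rewrite /Phi set_itv1 Rintegral_set1 mulr0 subr0.
  - move=> x l l0 xl; rewrite normr_gt0 subr_eq0 eq_sym => fxy.
    have [x' [d [d0 jd fd]]] := descent_step C1f (fs x)
      (fun u => tnorm_le_opnorm u (sigmaE x)) (sigma0 x) fxy eps0 eps1.
    exists x', d; split => //; apply: (le_trans fd).
    (* As x is within distance l of x0, h l <= 1 / sigma x; hence Phi grows over [l, l + d] by at
       most d * h l <= d / sigma x. *)
    rewrite lerD2l lerN2 -mulrBr; apply: ler_wpM2l; first lra.
    have ld : l <= l + d by rewrite lerDl ltW.
    have [_ /andP[_ Pl]] := nonincreasing_Rintegral_bounds hdec h0 l0 ld.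
    apply: (le_trans Pl); rewrite addrAC subrr add0r mulrC.
    by apply: ler_wpM2l; [exact: ltW | exact: hle].
by exists x => //; apply/eqP; rewrite eq_sym -subr_eq0 -normr_eq0 fx.
Qed.
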